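(* Let $d\ge 2$ be even and let $p,q\ge 1$ be integers with $n=p+q>d$. For any $0<\kappa<n-d$ and any $\xi\in\mathbb{R}$, for almost all $F\in Y^{(d)}_{p,q}$ the system of inequalities $$|F(v)-\xi|<t^{-\kappa},\qquad \|v\|\le t,$$ has a solution $v\in\mathbb{Z}^n$ for all sufficiently large $t$ (how large may depend on $F$).
   Context: $\|\cdot\|$ is the Euclidean norm on $\mathbb{R}^n$; vectors are row vectors. Let $F_0(v)=\sum_{i=1}^p v_i^d-\sum_{i=p+1}^n v_i^d$. For $g\in \mathrm{SL}_n(\mathbb{R})$ put $(g\cdot F_0)(v)=F_0(vg)$, and let $Y^{(d)}_{p,q}=\{g\cdot F_0: g\in \mathrm{SL}_n(\mathbb{R})\}$. ''Almost all $F\in Y^{(d)}_{p,q}$'' is with respect to the measure coming from the Haar measure of $\mathrm{SL}_n(\mathbb{R})$: a property holds for almost all $F$ if it holds for $F=g\cdot F_0$ for Haar-almost every $g\in \mathrm{SL}_n(\mathbb{R})$. *)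

(* Defs.v *)
From HB Require Import structures.
From mathcomp Require Import all_boot all_order all_algebra.
From mathcomp Require Import all_classical all_reals all_analysis.

Set Implicit Arguments.
Unset Strict Implicit.
Unset Printing Implicit Defensive.

Import Order.TTheory GRing.Theory Num.Theory.
Import numFieldNormedType.Exports.

Local Open Scope classical_set_scope.
Local Open Scope ring_scope.

Section SpecialLinearGroup.
Context (R : realType) (n : nat).

Definition SL_set : set 'M[R]_n := [set g | \det g = 1].

(* Carries the subspace topology induced by 'M[R]_n. *)
Definition SL : Type := set_type SL_set.

HB.instance Definition _ := Topological.on SL.

Definition SL_val (g : SL) : 'M[R]_n := set_val g.

Lemma SL_one_subproof : 1%:M \in SL_set.
Proof. by rewrite inE /SL_set /= det1. Qed.

Definition SL_one : SL :=
  exist (fun x => x \in SL_set) 1%:M SL_one_subproof.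

HB.instance Definition _ := isPointed.Build SL SL_one.

Lemma SL_mul_subproof (g h : SL) : SL_val g *m SL_val h \in SL_set.
Proof.
have dt (x : SL) : \det (SL_val x) = 1 by exact: (set_mem (valP x)).
by rewrite inE /SL_set /= det_mulmx !dt mulr1.
Qed.

Definition SL_mul (g h : SL) : SL :=
  exist (fun x => x \in SL_set) (SL_val g *m SL_val h) (SL_mul_subproof g h).

Definition SL_borel := g_sigma_algebraType (@open SL).

(* SL is locally compact and second countable, so regularity is automatic for
   Borel measures finite on compact sets. SL is unimodular, so left Haar
   measures are also right Haar measures. *)
Definition is_haar (mu : {measure set SL_borel -> \bar R}) : Prop :=
  [/\ forall (g : SL) (A : set SL_borel), measurable A ->
        mu [set SL_mul g h | h in A] = mu A,
      forall K : set SL, compact K -> (mu K < +oo)%E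
    & forall U : set SL, open U -> U !=set0 -> (0 < mu U)%E].

End SpecialLinearGroup.

Section Forms.
Context (R : realType) (n : nat).

Definition F0 (p d : nat) (v : 'rV[R]_n) : R :=
  \sum_(i < n | (i < p)%N) v 0 i ^+ d - \sum_(i < n | (p <= i)%N) v 0 i ^+ d.

Definition SL_act (g : SL R n) (F : 'rV[R]_n -> R) : 'rV[R]_n -> R :=
  fun v => F (v *m SL_val g).

(* The property P holds for almost all F in the SL-orbit of F0 p d. *)
Definition almost_all_Y (mu : {measure set (SL_borel R n) -> \bar R})
    (p d : nat) (P : ('rV[R]_n -> R) -> Prop) : Prop :=
  {ae mu, forall g, P (SL_act g (F0 p d))}.

(* The norm `|v| on 'rV[R]_n is the sup norm, hence this definition. *)
Definition enorm (v : 'rV[R]_n) : R := Num.sqrt (\sum_(i < n) v 0 i ^+ 2).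

Definition int_vec (v : 'rV[int]_n) : 'rV[R]_n := map_mx intr v.

End Forms.

(* Main.v *)
Require Import Defs.
From HB Require Import structures.
From mathcomp Require Import all_boot all_order all_algebra.
From mathcomp Require Import ring lra zify.
From mathcomp Require Import all_classical all_reals all_analysis.
From mathcomp Require Import measurable_realfun.

(* By left invariance, mu X is the average of mu (h^-1 X) over any finite set
   of h in SL_n(R), so it suffices to bound, for a fixed form G near g0 . F0,
   the proportion of h in a well-chosen finite set for which (h . G) misses
   the target at scale t = 2^j.  Write vectors as (x, u) with x the first
   coordinate, and let h_s be the shear (x, u) |-> (x + u.s, u), with s running
   over a grid of mesh 1/P, P a large prime.  For an integer vector u of size
   about t in a suitable cone, G(., u) = xi has a root because G changes sign
   on the line, and |G(x, u) - xi| < t^-kappa on an interval I_u around it, of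
   length l of order t^(-kappa - d + 1).  The events u.s in I_u + Z have
   probability l and, P being prime, are exactly independent for non-parallel
   u, u'.  There are about t^(n-1) vectors u and O(t^(n-1) log t) parallel
   pairs, so by Chebyshev's inequality the proportion of s for which no event
   occurs is O(t^(kappa + d - n) log t), which is summable over t = 2^j.
   Borel-Cantelli then applies near each g0. *)

Set Implicit Arguments.
Unset Strict Implicit.
Unset Printing Implicit Defensive.

Import Order.TTheory GRing.Theory Num.Theory.
Import numFieldNormedType.Exports.

Local Open Scope ring_scope.

(** * Pairwise independence over a finite field *)

(* Chebyshev's inequality for the number of [v] with [k \in E v], where each
   event has probability [L / q] and pairs outside [Par] are independent. *)
Lemma card_pairwise_independent_miss (K V : finType) (E : V -> {set K})
    (Par : {set V * V}) (q L : nat) :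
  (0 < q)%N ->
  (forall v, #|E v| * q = #|K| * L)%N ->
  (forall v w, (v, w) \notin Par ->
     #|E v :&: E w| * q ^ 2 = #|K| * L ^ 2)%N ->
  (#|[set k | [forall v, k \notin E v]]| * L * #|V| ^ 2
     <= #|K| * q * #|Par|)%N.
Proof.
move=> q0 hE hEE; set Z := [set k | _].
have [->|L0] := posnP L; first by rewrite muln0 mul0n.
pose ind v k : rat := (k \in E v)%:R.
pose N k := \sum_v ind v k.
(* The mean of [N], the number of events containing a given point. *)
pose e : rat := #|V|%:R * L%:R / q%:R.
have q0' : (0 : rat) < q%:R by rewrite ltr0n.
have L0' : (0 : rat) < L%:R by rewrite ltr0n.
have cardE (A : {set K}) : \sum_k (k \in A)%:R = #|A|%:R :> rat.
  by rewrite -natr_sum -sum1_card [in RHS]big_mkcond /=; congr (_%:R); apply: eq_bigr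
    => k _; case: (k \in A).
have sN : \sum_k N k = e * #|K|%:R.
  rewrite exchange_big /=.
  transitivity (\sum_(v : V) (#|K|%:R * L%:R / q%:R : rat)).
    apply: eq_bigr => v _; rewrite cardE.
    apply: (mulIf (lt0r_neq0 q0')); rewrite divfK ?lt0r_neq0//.
    by rewrite -!natrM hE.
  rewrite sumr_const -mulr_natl /e.
  by field; rewrite lt0r_neq0.
(* Independent pairs account for at most the square of the mean; a pair in [Par] costs at most the
   size of a single event. *)
have sN2 : \sum_k N k ^+ 2 <= e ^+ 2 * #|K|%:R + #|Par|%:R * #|K|%:R * L%:R / q%:R.
  have -> : \sum_k N k ^+ 2 = \sum_v \sum_w #|E v :&: E w|%:R.
    under eq_bigr do rewrite expr2 mulr_suml.
    rewrite exchange_big /=; apply: eq_bigr => v _.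
    under eq_bigr do rewrite mulr_sumr.
    rewrite exchange_big /=; apply: eq_bigr => w _.
    by rewrite -cardE; apply: eq_bigr => k _; rewrite inE -mulnb natrM.
  rewrite pair_big /=.
  apply: (@le_trans _ _ (\sum_(x : V * V) (#|K|%:R * L%:R ^+ 2 / q%:R ^+ 2 +
     (x \in Par)%:R * (#|K|%:R * L%:R / q%:R)))).
    apply: ler_sum => -[v w] _ /=.
    have [vw|vw] := boolP ((v, w) \in Par).
      rewrite mul1r; apply: ler_wpDl; first by rewrite divr_ge0 ?mulr_ge0 ?exprn_ge0
        ?ler0n.
      rewrite ler_pdivlMr// -!natrM ler_nat -(hE v) leq_mul2r.
      by rewrite subset_leq_card ?orbT// subsetIl.
    rewrite mul0r addr0 ler_pdivlMr ?exprn_gt0// -!natrX -!natrM ler_nat.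
    by rewrite hEE.
  rewrite big_split /= -[X in _ + X]mulr_suml.
  have -> : \sum_(x : V * V) (x \in Par)%:R = #|Par|%:R :> rat.
    by rewrite -natr_sum -sum1_card [in RHS]big_mkcond /=; congr (_%:R); apply:
      eq_bigr => k _; case: (k \in Par).
  rewrite sumr_const -[X in X + _ <= _]mulr_natl card_prod natrM !mulrA /e.
  rewrite lerD2r le_eqVlt; apply/orP; left; apply/eqP; field.
  by rewrite lt0r_neq0.
have var : \sum_k (N k - e) ^+ 2 <= #|Par|%:R * #|K|%:R * L%:R / q%:R.
  have -> : \sum_k (N k - e) ^+ 2 =
     \sum_k N k ^+ 2 - 2 * e * \sum_k N k + e ^+ 2 * #|K|%:R.
    rewrite mulr_sumr -sumrB.
    have -> : e ^+ 2 * #|K|%:R = \sum_(k : K) e ^+ 2.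
      by rewrite sumr_const mulr_natr.
    by rewrite -big_split /=; apply: eq_bigr => k _; ring.
  by rewrite sN; lra.
(* On [Z] the count [N] vanishes, so each of its points contributes [e ^+ 2] to the sum of squared
   deviations. *)
have low : #|Z|%:R * e ^+ 2 <= \sum_k (N k - e) ^+ 2.
  rewrite -cardE mulr_suml; apply: ler_sum => k _.
  have [|kZ] := boolP (k \in Z); last by rewrite mul0r sqr_ge0.
  rewrite inE => /forallP kZ; rewrite mul1r /N big1 ?sub0r ?sqrrN// => v _.
  by rewrite /ind (negbTE (kZ v)).
have := le_trans low var; rewrite /e ler_pdivlMr// -(ler_nat rat) => h.
rewrite !natrM.
suff : 0 <= L%:R / q%:R * (#|K|%:R * q%:R * #|Par|%:R - #|Z|%:R * L%:R * #|V|%:R ^+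
  2) :> rat.
  by rewrite pmulr_rge0 ?divr_gt0// subr_ge0 expr2.
rewrite -subr_ge0 in h.
have -> : L%:R / q%:R * (#|K|%:R * q%:R * #|Par|%:R - #|Z|%:R * L%:R * #|V|%:R ^+ 2)
  = #|Par|%:R * #|K|%:R * L%:R - #|Z|%:R * (#|V|%:R * L%:R / q%:R) ^+ 2 * q%:R :> rat.
  by field; rewrite lt0r_neq0.
exact: h.
Qed.

(** Translation by [y] carries the fiber over [a] onto the fiber over [b], so the fibers partition
    [V] into sets of equal size. *)
Lemma card_homogeneous_fiber (V : finZmodType) (A : finType) (f : V -> A) :
  (forall a b, exists y, forall x, (f (x + y) == b) = (f x == a)) ->
  forall a, (#|[set x | f x == a]| * #|A| = #|V|)%N.
Proof.
move=> fhom a.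
have same b : #|[set x | f x == b]| = #|[set x | f x == a]|.
  have [y fy] := fhom a b.
  rewrite -(card_imset [set x | f x == a] (addIr y)).
  apply: eq_card => x; rewrite inE; apply/idP/imsetP => [fx|[z]].
    by exists (x - y); rewrite ?subrK// inE -fy subrK.
  by rewrite inE -fy => fz ->.
rewrite -[RHS]sum1_card (partition_big f predT)//=.
rewrite (eq_bigr (fun=> #|[set x | f x == a]|)); last first.
  by move=> b _; rewrite sum1dep_card; apply: same.
by rewrite sum_nat_const mulnC.
Qed.

Section Dot.
Variables (F : finFieldType) (m : nat).
Implicit Types k u v : 'rV[F]_m.

Definition dotp u k : F := \sum_i k 0 i * u 0 i.

Lemma dotpD u x y : dotp u (x + y) = dotp u x + dotp u y.
Proof.
by rewrite /dotp -big_split; apply: eq_bigr => i _; rewrite !mxE mulrDl.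
Qed.

Lemma dotp_delta u i a : dotp u (a *: delta_mx 0 i) = a * u 0 i.
Proof.
rewrite /dotp (bigD1 i)//= !mxE !eqxx mulr1 big1 ?addr0// => j ji.
by rewrite !mxE (negbTE ji) andbF mulr0 mul0r.
Qed.

(** Moving [k] along a coordinate where [u] is nonzero shifts [dotp u k] by any prescribed amount,
    so the dot product is equidistributed. *)
Lemma card_dotp u (J : {set F}) : u != 0 ->
  (#|[set k | dotp u k \in J]| * #|F| = #|{: 'rV[F]_m}| * #|J|)%N.
Proof.
move=> u0; have [i ui] : exists i, u 0 i != 0 by apply/rV0Pn.
have fs a b : exists y, forall k, (dotp u (k + y) == b) = (dotp u k == a).
  exists (((b - a) / u 0 i) *: delta_mx 0 i) => k.
  rewrite dotpD dotp_delta divfK// addrCA -subr_eq0.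
  by rewrite -[RHS]subr_eq0; congr (_ == _); ring.
rewrite -[#|[set k | _]|]sum1_card (partition_big (dotp u) [in J])/=; last first.
  by move=> k; rewrite inE.
rewrite mulnC big_distrr /=.
rewrite (eq_bigr (fun=> #|{: 'rV[F]_m}|)); first by rewrite sum_nat_const mulnC.
move=> a aJ; rewrite -(card_homogeneous_fiber fs a) mulnC; congr (_ * _)%N.
rewrite -sum1_card; apply: eq_bigl => k; rewrite !inE.
by have [->|] := eqVneq (dotp u k) a; rewrite ?aJ ?andbF.
Qed.

(** A nonzero minor makes the pair of dot products equidistributed on the plane: the two events are
    exactly independent. *)
Lemma card_dotp2 u v (J K : {set F}) i j : u 0 i * v 0 j != u 0 j * v 0 i ->
  (#|[set k | dotp u k \in J] :&: [set k | dotp v k \in K]| * #|F| ^ 2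
   = #|{: 'rV[F]_m}| * (#|J| * #|K|))%N.
Proof.
rewrite -subr_eq0; set D := (X in X != 0) => D0.
pose dotp2 k := (dotp u k, dotp v k).
have fs a b : exists y, forall k, (dotp2 (k + y) == b) = (dotp2 k == a).
  case: a b => [a a'] [b b'].
  (* Cramer's rule for the translation that shifts the two dot products by [b - a] and [b' - a']. *)
  exists ((((b - a) * v 0 j - (b' - a') * u 0 j) / D) *: delta_mx 0 i
     + (((b' - a') * u 0 i - (b - a) * v 0 i) / D) *: delta_mx 0 j) => k.
  rewrite !xpair_eqE /= !dotpD !dotp_delta.
  rewrite -(subr_eq0 (dotp u k + _)) -(subr_eq0 (dotp v k + _)).
  rewrite -(subr_eq0 (dotp u k)) -(subr_eq0 (dotp v k)).
  by congr andb; congr (_ == _); rewrite /D; field.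
rewrite -[#|_ :&: _|]sum1_card.
rewrite (partition_big dotp2 [in finset.setX J K])/=; last first.
  by move=> k; rewrite !inE.
rewrite mulnC big_distrr /=.
rewrite (eq_bigr (fun=> #|{: 'rV[F]_m}|)); first by rewrite sum_nat_const cardsX mulnC.
move=> [a b] aJ; rewrite -(card_homogeneous_fiber fs (a, b)) mulnC card_prod mulnn.
congr (_ * _)%N.
rewrite -sum1_card; apply: eq_bigl => k; rewrite !inE.
move: aJ; rewrite inE /= => /andP[aJ bK].
have [[-> ->]|] := eqVneq (dotp2 k) (a, b); rewrite ?aJ ?bK ?andbF//.
Qed.

End Dot.

(** * Counting parallel pairs of integer vectors *)

(** Each dyadic block of the harmonic sum contributes at most 1. *)
Lemma harmonic_pow2_le K : \sum_(1 <= e < 2 ^ K.+1) (e%:R^-1 : rat) <= K.+1%:R.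
Proof.
elim: K => [|K IH]; first by rewrite big_nat1 invr1.
rewrite (@big_cat_nat _ _ _ (2 ^ K.+1)) ?expn_gt0//=; last by rewrite leq_exp2l.
rewrite -[in leRHS]natr1 lerD//.
apply: (@le_trans _ _ (\sum_(2 ^ K.+1 <= e < 2 ^ K.+2) (2 ^ K.+1)%:R^-1)).
  rewrite !big_nat; apply: ler_sum => e /andP[h _].
  by rewrite lef_pV2 ?ler_nat// posrE ltr0n ?expn_gt0// (leq_trans _ h)// expn_gt0.
rewrite sumr_const_nat [in (2 ^ K.+2)%N]expnS mul2n -addnn addnK -[leLHS]mulr_natl.
by rewrite mulfV// pnatr_eq0 expn_eq0.
Qed.

Definition parallel m (v w : 'I_m -> int) :=
  [forall i, forall j, v i * w j == v j * w i].

Lemma parallelP m (v w : 'I_m -> int) :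
  reflect (forall i j, v i * w j = v j * w i) (parallel v w).
Proof. by apply: (iffP 'forall_'forall_eqP). Qed.

(** Let [a / b] be [v i / w i] in lowest terms. Then [a * w j = b * v j], and coprimality makes [a]
    divide every [v j]; [z] is the quotient. *)
Lemma parallel_common_factor m (v w : 'I_m -> int) i : v i != 0 -> parallel v w ->
  exists a b z, (forall j, v j = a * z j) /\ (forall j, w j = b * z j).
Proof.
move=> vi /parallelP vw; set g := gcdz (v i) (w i).
have g0 : g != 0 by rewrite gcdz_eq0 (negbTE vi).
pose a := (v i %/ g)%Z; pose b := (w i %/ g)%Z.
have va : v i = a * g by rewrite divzK// dvdz_gcdl.
have wb : w i = b * g by rewrite divzK// dvdz_gcdr.
have ab j : a * w j = b * v j.
  by apply: (mulIf g0); rewrite mulrAC -va vw wb; ring.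
have a0 : a != 0 by apply: contraNneq vi; rewrite va => ->; rewrite mul0r.
have cop : coprimez a b.
  have gge : 0 <= g by [].
  have : g = gcdz a b * g by rewrite {1}/g va wb -mulz_gcdl gez0_abs.
  by rewrite -[X in X = _]mul1r => /(mulIf g0) h; rewrite /coprimez -h.
exists a, b, (fun j => (v j %/ a)%Z).
have dv j : (a %| v j)%Z by rewrite -(Gauss_dvdzr _ cop) -ab dvdz_mulr.
have vE j : v j = a * (v j %/ a)%Z by rewrite mulrC divzK.
split=> // j; apply: (mulfI a0); rewrite ab {1}vE; ring.
Qed.

(* Parallel vectors are [a z] and [b z] with [a], [b] integers; [e] stands for
   [max |a| |b|], so that the entries of [z] are at most [B / e]. *)
Lemma card_parallel_pairs (T : finType) m B (vec : T -> 'I_m -> int) :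
  (forall x y, vec x =1 vec y -> x = y) ->
  (forall x, exists i, vec x i != 0) ->
  (forall x i, `|vec x i| <= B%:Z) ->
  (#|[set xy : T * T | parallel (vec xy.1) (vec xy.2)]| <=
     \sum_(1 <= e < B.+1) 2 * (e.*2.+1 * (B %/ e).*2.+1 ^ m))%N.
Proof.
move=> vinj vn0 vB.
(* The boolean tells which vector carries the larger factor. The sign of that factor is moved into
   [z], so it equals [e]; the other factor lies in [[-e, e]]. Both ranges are shifted to start at
   0. *)
pose code e : finType := (bool * ('I_e.*2.+1 * {ffun 'I_m -> 'I_((B %/
  e).*2.+1)}))%type.
pose cz e (c : code e) i : int := (c.2.2 i)%:Z - (B %/ e)%N%:Z.
pose u e (c : code e) i : int := e%:Z * cz e c i.
pose w e (c : code e) i : int := ((c.2.1)%:Z - e%:Z) * cz e c i.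
pose good e (c : code e) (x y : T) :=
  [forall i, (vec x i == if c.1 then u e c i else w e c i)] &&
  [forall i, (vec y i == if c.1 then w e c i else u e c i)].
pose Pe e := [set xy : T * T | [exists c : code e, good e c xy.1 xy.2]].
have cPe e : (#|Pe e| <= 2 * (e.*2.+1 * (B %/ e).*2.+1 ^ m))%N.
  have -> : (2 * (e.*2.+1 * (B %/ e).*2.+1 ^ m) = #|code e|)%N.
    by rewrite !card_prod card_bool card_ffun !card_ord.
  have [c0|] := posnP #|code e|.
    rewrite c0 leqn0 cards_eq0; apply/eqP/setP => xy; rewrite !inE.
    by apply/negbTE/existsP => -[c _]; have := fintype0 c c0.
  case/card_gt0P => c0 _.
  pose f (xy : T * T) : code e := odflt c0 [pick c | good e c xy.1 xy.2].
  have fP xy : xy \in Pe e -> good e (f xy) xy.1 xy.2.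
    rewrite inE /f => /existsP[c hc]; case: pickP => // /(_ c).
    by rewrite hc.
  rewrite -(@card_in_imset _ _ f (Pe e)) ?max_card//.
  move=> [x y] [x' y'] /fP/= + /fP/= + E; rewrite E.
  move=> /andP[/'forall_eqP h1 /'forall_eqP h2] /andP[/'forall_eqP h3 /'forall_eqP h4].
  by congr (_, _); apply: vinj => i; rewrite ?h1 ?h2 ?h3 ?h4.
apply: (@leq_trans (\sum_(1 <= e < B.+1) #|Pe e|)); last exact: leq_sum.
have cE (A : {set T * T}) : #|A| = (\sum_xy (xy \in A))%N.
  by rewrite -sum1_card big_mkcond; apply: eq_bigr => xy _; case: (xy \in A).
under eq_bigr do rewrite cE.
rewrite exchange_big cE /=; apply: leq_sum => -[x y] _.
have [|//] := boolP (_ \in _); rewrite inE /= => xy.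
suff [e /andP[e0 eB] he] : exists2 e, (0 < e <= B)%N & (x, y) \in Pe e.
  by rewrite (big_rem e) ?he ?mem_index_iota ?e0//= ?ltnS ?eB.
have inord e (z : int) : (`|z| <= e%:Z) -> exists t : 'I_e.*2.+1, (t%:Z - e%:Z = z).
  move=> ze; have h : (absz (z + e%:Z)%R < e.*2.+1)%N by lia.
  by exists (Ordinal h) => /=; lia.
have key (a b : int) (z : 'I_m -> int) (v v' : T) :
    (forall j, vec v j = a * z j) -> (forall j, vec v' j = b * z j) ->
    `|b| <= `|a| -> exists e, [/\ (0 < e <= B)%N,
     forall i, `|sgz a * z i| <= (B %/ e)%N%:Z, `|sgz a * b| <= e%:Z,
     forall i, vec v i = e%:Z * (sgz a * z i) &
     forall i, vec v' i = (sgz a * b) * (sgz a * z i)].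
  move=> va vb ba; have [i vi] := vn0 v.
  have a0 : a != 0 by apply: contraNneq vi; rewrite va => ->; rewrite mul0r.
  have sa : sgz a * sgz a = 1 by rewrite -expr2 sqr_sg a0.
  have az j : (absz a * absz (z j) <= B)%N.
    by have := vB v j; rewrite va normrM; lia.
  exists (absz a); split.
  - have zi : z i != 0 by apply: contraNneq vi; rewrite va => ->; rewrite mulr0.
    have := az i; rewrite absz_gt0 a0 /= => h; apply: leq_trans h.
    by rewrite leq_pmulr// absz_gt0.
  - move=> j; rewrite normrM normr_sgz a0 mul1r.
    have : (absz (z j) <= B %/ absz a)%N by rewrite leq_divRL ?absz_gt0// mulnC.
    by rewrite -lez_nat abszE.
  - by rewrite normrM normr_sgz a0 mul1r abszE.
  - by move=> j; rewrite va abszE mulrA -[X in _ = X * _]mulrC normrEsg mulrA sgrz sa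
    mul1r.
  - by move=> j; rewrite vb mulrACA sa mul1r.
have [i vi] := vn0 x.
have [a [b [z [hx hy]]]] := parallel_common_factor vi xy.
have [ba|/ltW ab] := lerP `|b| `|a|.
  have [e [eB zB fB ux wy]] := key a b z x y hx hy ba; exists e => //.
  have [t ht] := inord _ _ fB; have := fun i => inord _ _ (zB i).
  move=> /fin_all_exists[g hg].
  rewrite inE; apply/existsP; exists (true, (t, [ffun i => g i])).
  by apply/andP; split; apply/'forall_eqP => j;
    rewrite /= /u /w /cz /= ffunE hg ?ux ?wy ?ht.
have [e [eB zB fB ux wy]] := key b a z y x hy hx ab; exists e => //.
have [t ht] := inord _ _ fB; have := fun i => inord _ _ (zB i).
move=> /fin_all_exists[g hg].
rewrite inE; apply/existsP; exists (false, (t, [ffun i => g i])).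
by apply/andP; split; apply/'forall_eqP => j;
  rewrite /= /u /w /cz /= ffunE hg ?ux ?wy ?ht.
Qed.

(** With [B = 2 ^ K], a summand is at most [6 * 3^m * B^m * e^(1 - m)]. For [m >= 2] this is at most
    a constant times [B^m / e], and the harmonic sum yields the factor [K.+1]. *)
Lemma parallel_count_sum_le m K : (1 < m)%N ->
  (\sum_(1 <= e < (2 ^ K).+1) 2 * (e.*2.+1 * ((2 ^ K) %/ e).*2.+1 ^ m)
     <= 6 * 3 ^ m * 2 ^ (K * m) * K.+1)%N.
Proof.
case: m => [|[|m]]// _; set B := (2 ^ K)%N.
have B0 : (0 < B)%N by rewrite expn_gt0.
rewrite -(ler_nat rat) natr_sum.
apply: (@le_trans _ _ ((6 * 3 ^ m.+2 * 2 ^ (K * m.+2))%:R *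
   \sum_(1 <= e < B.+1) e%:R^-1)); last first.
  rewrite [in leRHS]natrM ler_wpM2l// (le_trans _ (harmonic_pow2_le K))//.
  rewrite (@big_cat_nat _ _ _ B.+1 1 (2 ^ K.+1))//=; last first.
    by rewrite expnS mul2n -addnn -/B; lia.
  by rewrite lerDl; apply: sumr_ge0 => e _; rewrite invr_ge0.
rewrite mulr_sumr !big_nat; apply: ler_sum => e /andP[e0 eB].
have e0' : (0 : rat) < e%:R by rewrite ltr0n.
have Be0 : (0 < B %/ e)%N by rewrite divn_gt0// -ltnS.
have Be : ((B %/ e)%:R <= B%:R / e%:R :> rat).
  by rewrite ler_pdivlMr// -natrM ler_nat leq_trunc_div.
apply: (@le_trans _ _ ((6 * e)%:R * (3 * (B%:R / e%:R)) ^+ m.+2)).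
  rewrite mulnA natrM ler_pM//; first by rewrite ler_nat; lia.
  have h : (((B %/ e).*2.+1)%:R <= 3 * (B%:R / e%:R) :> rat).
    apply: (@le_trans _ _ (3 * (B %/ e))%:R).
      by rewrite ler_nat; move: (B %/ e)%N Be0 => b; lia.
    by rewrite natrM ler_wpM2l.
  by rewrite natrX lerXn2r ?nnegrE//; apply: le_trans h.
have cE : (6 * 3 ^ m.+2 * 2 ^ (K * m.+2))%:R = 6 * 3 ^+ m.+2 * B%:R ^+ m.+2 :> rat.
  by rewrite expnM -/B natrM (natrX _ B) natrM (natrX _ 3).
rewrite cE natrM exprMn exprMn exprVn.
have -> : 6 * e%:R * (3 ^+ m.+2 * (B%:R ^+ m.+2 / e%:R ^+ m.+2)) =
  6 * 3 ^+ m.+2 * B%:R ^+ m.+2 * e%:R^-1 * (e%:R^-1 ^+ m) :> rat.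
  by rewrite !exprS exprVn; field; rewrite expf_neq0 ?lt0r_neq0.
apply: ler_piMr; first by rewrite -cE divr_ge0.
rewrite exprn_ile1 ?invr_ge0//.
by rewrite invf_le1// ler1n.
Qed.

(** * Counting the parameters modulo a prime that miss every event *)

Lemma Fp_intr_eq0 P (z : int) : prime P -> ((z%:~R : 'F_P) == 0) = (P %| absz z)%N.
Proof.
move=> pP; rewrite (dvdn_pcharf (pchar_Fp pP)).
by case: (intP z) => // n; rewrite ?mulrNz ?oppr_eq0 ?abszN -pmulrn.
Qed.

(** The vectors have entries at most [2 ^ K], so their minors are at most [2 * (2 ^ K) ^ 2 < P].
    Nonzero entries and minors thus stay nonzero modulo [P], and only pairs parallel over the
    integers can fail to be independent. *)
Lemma card_dotp_box_miss m K k P L (c : 'I_m -> int)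
    (J : {ffun 'I_m -> 'I_(2 ^ k)} -> {set 'F_P}) :
  (1 < m)%N -> prime P -> (2 * (2 ^ K) ^ 2 < P)%N ->
  (forall (x : {ffun 'I_m -> 'I_(2 ^ k)}) i, `|c i + (x i)%:Z| <= (2 ^ K)%N%:Z) ->
  (forall x : {ffun 'I_m -> 'I_(2 ^ k)}, exists i, c i + (x i)%:Z != 0) ->
  (forall x, #|J x| = L) ->
  (#|[set r : 'rV['F_P]_m | [forall x : {ffun 'I_m -> 'I_(2 ^ k)},
        dotp (\row_i (c i + (x i)%:Z)%:~R) r \notin J x]]| * L * (2 ^ (k * m)) ^ 2
     <= P ^ m * P * (6 * 3 ^ m * 2 ^ (K * m) * K.+1))%N.
Proof.
move=> m1 pP PK cB c0 JL.
pose vec (x : {ffun 'I_m -> 'I_(2 ^ k)}) i := c i + (x i)%:Z.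
pose Par := [set xy | parallel (vec xy.1) (vec xy.2)].
have vinj x y : vec x =1 vec y -> x = y.
  by move=> xy; apply/ffunP => i; apply/val_inj; have := xy i; rewrite /vec => /addrI[].
have cP : #|'F_P| = P by rewrite card_Fp.
have crV : #|{: 'rV['F_P]_m}| = (P ^ m)%N by rewrite card_mx cP mul1n.
have big (z : int) : `|z| < P%:Z -> z != 0 -> (z%:~R : 'F_P) != 0.
  move=> zP z0; rewrite Fp_intr_eq0//; apply/negP => /dvdn_leq.
  by rewrite absz_gt0 z0 => /(_ isT); lia.
pose E x := [set r : 'rV['F_P]_m | dotp (\row_i (vec x i)%:~R) r \in J x].
have := @card_pairwise_independent_miss _ _ E Par P L (prime_gt0 pP).
rewrite crV => H.
have KP : (2 ^ K < P)%N.
  by apply: leq_ltn_trans PK; rewrite expnS expn1 mulnA leq_pmull// muln_gt0 expn_gt0.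
have /H {H} H1 : forall v, (#|E v| * P = P ^ m * L)%N.
  move=> v; rewrite -[X in (_ * X)%N]cP card_dotp ?crV ?JL//.
  have [i vi] := c0 v; apply/rV0Pn; exists i; rewrite mxE big//.
  by apply: le_lt_trans (cB v i) _; lia.
have H2 v w : (v, w) \notin Par -> (#|E v :&: E w| * P ^ 2 = P ^ m * L ^ 2)%N.
  rewrite inE /= => /forallPn[i /forallPn[j vw]].
  rewrite -[X in (_ * X ^ 2)%N]cP (@card_dotp2 _ _ _ _ _ _ i j) ?crV ?JL ?mulnn//.
  rewrite !mxE -!intrM -subr_eq0 -intrB big ?subr_eq0//.
  apply: (@le_lt_trans _ _ (2 * (2 ^ K) ^ 2)%N%:Z); last by rewrite ltz_nat.
  have h (a b a' b' : int) (B : nat) : `|a| <= B%:Z -> `|b| <= B%:Z -> `|a'| <= B%:Z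
    -> `|b'| <= B%:Z ->
     `|a * b - a' * b'| <= (2 * B ^ 2)%N%:Z.
    move=> ? ? ? ?; apply: le_trans (ler_normB _ _) _; rewrite mul2n -addnn PoszD
      !normrM.
    by rewrite lerD// expnS expn1 PoszM ler_pM.
  by apply: h; apply: cB.
have := H1 H2; rewrite card_ffun !card_ord -(expnM 2 k m) => {H1 H2}.
move=> h; set Z := #|_|.
have -> : Z = #|[set r | [forall x, r \notin E x]]|.
  by apply: eq_card => r; rewrite !inE; apply: eq_forallb => x; rewrite inE.
apply: leq_trans h _; rewrite leq_mul2l; apply/orP; right.
apply: leq_trans (parallel_count_sum_le _ m1).
exact: card_parallel_pairs.
Qed.

(** * The form F0 *)

Section Form.
Variables (R : realType) (n p d : nat).
Implicit Types v w x y r : 'rV[R]_n.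
Local Notation F := (@F0 R n p d).
Local Notation sg i := (if (i < p)%N then 1 else -1 : R).

Lemma F0E v : F v = \sum_(i < n) (if (i < p)%N then 1 else -1) * v 0 i ^+ d.
Proof.
rewrite /F0 [RHS](bigID (fun i : 'I_n => (i < p)%N))/=; congr (_ + _).
  by apply: eq_bigr => i ->; rewrite mul1r.
rewrite -sumrN; apply: eq_big => i; first by rewrite ltnNge negbK.
by rewrite leqNgt => /negbTE ->; rewrite mulN1r.
Qed.

Lemma F0Z a v : F (a *: v) = a ^+ d * F v.
Proof.
by rewrite !F0E mulr_sumr; apply: eq_bigr => i _; rewrite mxE exprMn mulrCA.
Qed.

Lemma F0_delta a i : (0 < d)%N ->
  F (a *: delta_mx 0 i) = (if (i < p)%N then 1 else -1) * a ^+ d.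
Proof.
move=> d0; rewrite F0Z mulrC F0E (bigD1 i)//= mxE !eqxx expr1n mulr1 big1 ?addr0//.
by move=> j ji; rewrite mxE (negbTE ji) andbF expr0n gtn_eqF ?mulr0.
Qed.

Lemma expr_lipschitz (K a b : R) : `|a| <= K -> `|b| <= K ->
  `|a ^+ d - b ^+ d| <= d%:R * K ^+ d.-1 * `|a - b|.
Proof.
move=> aK bK; rewrite subrXX normrM mulrC ler_wpM2r//.
apply: le_trans (ler_norm_sum _ _ _) _.
rewrite -[X in X%:R * _](card_ord d) mulr_natl -sumr_const.
apply: ler_sum => i _; rewrite normrM !normrX.
have -> : d.-1 = (d.-1 - i + i)%N by rewrite subnK// -ltnS prednK// (leq_ltn_trans _
  (ltn_ord i)).
rewrite exprD.
by rewrite addnK; apply: ler_pM; rewrite ?exprn_ge0// lerXn2r ?nnegrE// (le_trans _ aK).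
Qed.

Lemma F0_lipschitz (K e : R) x y : (forall i, `|x 0 i| <= K) ->
  (forall i, `|y 0 i| <= K) -> (forall i, `|x 0 i - y 0 i| <= e) ->
  `|F x - F y| <= n%:R * (d%:R * K ^+ d.-1 * e).
Proof.
move=> xK yK xy; rewrite !F0E -sumrB.
apply: le_trans (ler_norm_sum _ _ _) _.
rewrite -[X in X%:R * _](card_ord n) mulr_natl -sumr_const.
apply: ler_sum => i _; rewrite -mulrBr normrM.
have -> : `|sg i| = 1 by case: ifP; rewrite ?normrN normr1.
rewrite mul1r; apply: le_trans (expr_lipschitz (xK i) (yK i)) _.
by rewrite ler_wpM2l// mulr_ge0// exprn_ge0// (le_trans _ (xK i)).
Qed.

Lemma row_bounded x : exists2 K : R, 0 <= K & forall i, `|x 0 i| <= K.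
Proof.
exists (\sum_i `|x 0 i|); first exact: sumr_ge0.
by move=> i; rewrite (bigD1 i)//= lerDl sumr_ge0.
Qed.

Lemma F0_near_sign (z w : 'rV[R]_n) : F w != 0 ->
  exists2 e : R, 0 < e & `|F (w + e *: z) - F w| < `|F w|.
Proof.
move=> Fw; have [K K0 wK] := row_bounded w; have [A A0 zA] := row_bounded z.
pose D := n%:R * (d%:R * (K + A) ^+ d.-1 * A).
have D0 : 0 <= D by rewrite /D !mulr_ge0// exprn_ge0// addr_ge0.
have Fw0 : 0 < `|F w| by rewrite normr_gt0.
have D1 : 0 < D + `|F w| by rewrite ltr_wpDl.
(* Makes [D * e] smaller than the absolute value of [F w]; [D] is a Lipschitz constant for steps
   [e <= 1]. *)
pose e := `|F w| / (D + `|F w|).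
have e0 : 0 < e by rewrite divr_gt0.
have e1 : e <= 1 by rewrite ler_pdivrMr// mul1r lerDr.
exists e => //.
apply: le_lt_trans (@F0_lipschitz (K + A) (e * A) _ _ _ _ _) _.
- move=> i; rewrite !mxE (le_trans (ler_normD _ _))// lerD// normrM gtr0_norm//.
  by rewrite (le_trans _ (zA i))// ler_piMl.
- by move=> i; rewrite (le_trans (wK i))// lerDl.
- by move=> i; rewrite !mxE addrAC subrr add0r normrM gtr0_norm// ler_wpM2l// ltW.
have -> : n%:R * (d%:R * (K + A) ^+ d.-1 * (e * A)) = D * e by rewrite /D; ring.
rewrite /e mulrCA gtr_pMr// ltr_pdivrMr// mul1r ltrDl//.
Qed.

(** If [F r] is nonzero, join a small multiple of a basis vector on which [F] has the opposite sign
    to a point near [r] where [F] keeps the sign of [F r]. Coordinate 0 is positive and coordinate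
    [p] is negative for [F]. *)
Lemma F0_indefinite_line r : (0 < p < n)%N -> (1 < d)%N -> ~~ odd d -> r != 0 ->
  exists y s, F y < 0 /\ 0 < F (y + s *: r).
Proof.
move=> /andP[p0 pn] d1 dev r0.
have d0 : (0 < d)%N by exact: ltnW.
have n0 : (0 < n)%N by exact: leq_ltn_trans pn.
have [Fr|Fr|Fr] := ltgtP (F r) 0.
- have [e e0] := F0_near_sign (delta_mx 0 (Ordinal n0)) (ltr0_neq0 Fr).
  rewrite (ltr0_norm Fr) => he.
  exists (r + e *: delta_mx 0 (Ordinal n0)), (-1); split.
    by move: he => /(le_lt_trans (ler_norm _)); lra.
  by rewrite scaleN1r addrAC subrr add0r F0_delta// p0 mul1r exprn_gt0.
- have [e e0] := F0_near_sign (delta_mx 0 (Ordinal pn)) (lt0r_neq0 Fr).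
  rewrite (gtr0_norm Fr) => he.
  exists (e *: delta_mx 0 (Ordinal pn)), 1; split.
    by rewrite F0_delta//= ltnn mulN1r oppr_lt0 exprn_gt0.
  rewrite scale1r addrC.
  by move: he; rewrite distrC => /(le_lt_trans (ler_norm _)); lra.
(* If [F r = 0] then [F (delta_i + s r)] is [(1 + s r_i)^d - (s r_i)^d] up to
   sign; take [s r_i = -1] and [s r_i = 1]. *)
have /rV0Pn[i ri] := r0.
have key s : F (delta_mx 0 i + s *: r) = sg i * ((1 + s * r 0 i) ^+ d - (s * r 0 i)
  ^+ d).
  have : F (s *: r) = 0 by rewrite F0Z Fr mulr0.
  rewrite F0E (bigD1 i)//= mxE => /eqP; rewrite addrC addr_eq0 => /eqP h.
  rewrite F0E (bigD1 i)//= !mxE !eqxx mulrBr; congr (_ + _); rewrite -h.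
  by apply: eq_bigr => j ji; rewrite !mxE (negbTE ji) andbF add0r.
pose y s := delta_mx 0 i + (s / r 0 i) *: r.
have Fm : F (y (-1)) = - sg i.
  by rewrite key divfK// subrr expr0n gtn_eqF// -signr_odd (negbTE dev) sub0r mulrN1.
have Fp : F (y 1) = sg i * (2 ^+ d - 1) by rewrite key divfK// expr1n.
have two : 0 < 2 ^+ d - 1 :> R by rewrite subr_gt0 exprn_egt1// ?ltr1n// -lt0n.
have yD s t : y t = y s + ((t - s) / r 0 i) *: r.
  by rewrite /y -addrA -scalerDl; congr (_ + _ *: _); ring.
have [ip|ip] := ltnP i p.
  exists (y (-1)), ((1 - -1) / r 0 i); rewrite -yD Fm Fp ip; split; lra.
exists (y 1), ((-1 - 1) / r 0 i); rewrite -yD Fm Fp ltnNge ip /=; split; lra.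
Qed.

End Form.

Lemma mulmx_row_bound (R : realFieldType) n (v : 'rV[R]_n) (g : 'M[R]_n) (B G : R) :
  (forall i, `|v 0 i| <= B) -> (forall i j, `|g i j| <= G) ->
  forall j, `|(v *m g) 0 j| <= n%:R * (B * G).
Proof.
move=> vB gG j; rewrite mxE (le_trans (ler_norm_sum _ _ _))//.
rewrite -[X in X%:R * _](card_ord n) mulr_natl -sumr_const.
by apply: ler_sum => i _; rewrite normrM ler_pM.
Qed.

Lemma mulmx_row_perturb (R : realFieldType) n (v w : 'rV[R]_n) (g h : 'M[R]_n) (A e :
  R) :
  (forall i, `|v 0 i| <= A) -> (forall i, `|v 0 i - w 0 i| <= e) ->
  (forall i j, `|g i j| <= A) -> (forall i j, `|h i j - g i j| <= e) ->
  forall j, `|(v *m g) 0 j - (w *m h) 0 j| <= n%:R * ((2 * A + e) * e).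
Proof.
move=> vA vw gA gh j; rewrite !mxE -sumrB (le_trans (ler_norm_sum _ _ _))//.
rewrite -[X in X%:R * _](card_ord n) mulr_natl -sumr_const.
apply: ler_sum => i _.
have -> : v 0 i * g i j - w 0 i * h i j =
  (v 0 i - w 0 i) * g i j - v 0 i * (h i j - g i j) + (v 0 i - w 0 i) * (h i j - g i
    j) by ring.
rewrite (le_trans (ler_normD _ _))// (mulrDl (2 * A)) lerD//; last by rewrite normrM
  ler_pM.
rewrite (le_trans (ler_normB _ _))// !normrM (_ : 2 * A * e = e * A + A * e); last by
  ring.
by rewrite lerD// ler_pM.
Qed.

Lemma mx_bounded (R : realFieldType) m n (g : 'M[R]_(m, n)) :
  exists2 K : R, 0 <= K & forall i j, `|g i j| <= K.
Proof.
exists (\sum_i \sum_j `|g i j|); first by apply: sumr_ge0 => i _; exact: sumr_ge0.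
move=> i j; rewrite (bigD1 i)//= (bigD1 j)//= -addrA lerDl addr_ge0 ?sumr_ge0// => k _.
exact: sumr_ge0.
Qed.

(** * Sign changes and roots along lines, uniformly near a matrix *)

Section Local.
Variables (R : realType) (m p d : nat).
Local Notation n := (1 + m)%N.
Local Notation F := (@F0 R n p d).

(** Varying the first coordinate moves the image under [g0] along its first row. A line in that
    direction on which [F] takes both signs is pulled back by [g0], and the signs persist under
    small perturbations. *)
Lemma uniform_signs (g0 : 'M[R]_n) :
  (0 < p < n)%N -> (1 < d)%N -> ~~ odd d -> \det g0 = 1 ->
  exists (a b : R) (u0 : 'rV[R]_m) (c eta : R), [/\ 0 < c, 0 < eta, eta <= 1 &
    forall (g : 'M[R]_n) (u : 'rV[R]_m), (forall i j, `|g i j - g0 i j| <= eta) ->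
      (forall i, `|u 0 i - u0 0 i| <= eta) ->
      F (row_mx a%:M u *m g) <= - c /\ c <= F (row_mx b%:M u *m g)].
Proof.
move=> pn d1 dev dg.
have gu : g0 \in unitmx by rewrite unitmxE dg unitr1.
have rE : row 0 g0 = row_mx 1%:M 0 *m g0.
  rewrite rowE; congr (_ *m _); apply/rowP => i; rewrite !mxE /=.
  case: splitP => j; first by rewrite ord1 => /= i0; rewrite mxE -val_eqE /= i0 !eqxx.
  by move=> ij; rewrite mxE -val_eqE /= ij.
have r0 : row 0 g0 != 0.
  apply/eqP => /(congr1 (mulmx^~ (invmx g0))); rewrite rE mulmxK// mul0mx.
  move=> /matrixP /(_ 0 (lshift m 0)); rewrite row_mxEl !mxE eqxx => /eqP.
  by rewrite oner_eq0.
have [y [s [Fy Fys]]] := @F0_indefinite_line R n p d _ pn d1 dev r0.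
pose w : 'rV[R]_(1 + m) := y *m invmx g0.
pose a := w 0 (lshift m 0); pose u0 := rsubmx w.
have wE : row_mx a%:M u0 = w.
  by rewrite -[RHS]hsubmxK; congr row_mx; apply/rowP => i; rewrite !ord1 [LHS]mxE
    [RHS]mxE eqxx.
have ya : row_mx a%:M u0 *m g0 = y by rewrite wE mulmxKV.
have yb : row_mx (a + s)%:M u0 *m g0 = y + s *: row 0 g0.
  rewrite rE scalemxAl scale_row_mx scaler0 scale_scalar_mx mulr1 -ya -mulmxDl.
  by rewrite add_row_mx addr0 raddfD.
have [A1 A10 hA1] := row_bounded (row_mx a%:M u0 : 'rV[R]_(1 + m)).
have [A2 A20 hA2] := row_bounded (row_mx (a + s)%:M u0 : 'rV[R]_(1 + m)).
have [A3 A30 hA3] := mx_bounded g0.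
pose A := A1 + A2 + A3.
have A0 : 0 <= A by rewrite !addr_ge0.
pose K : R := n%:R * ((A + 1) * (A + 1)).
have K0 : 0 <= K by rewrite !mulr_ge0// addr_ge0.
(* [D * eta] bounds the change of [F] when [g] and [u] move by at most [eta <= 1]. *)
pose D : R := n%:R * (d%:R * K ^+ d.-1 * (n%:R * (2 * A + 1))).
have D0 : 0 <= D by rewrite /D; do ?[apply: exprn_ge0 | apply: mulr_ge0 | apply:
  addr_ge0].
(* Half of the smaller absolute value, so that an error of [c] still leaves [c]. *)
pose c := Num.min (- F y) (F (y + s *: row 0 g0)) / 2.
have c0 : 0 < c by rewrite divr_gt0// lt_min oppr_gt0 Fy.
have D1 : 0 < D + 1 by rewrite ltr_wpDl.
pose eta := Num.min 1 (c / (D + 1)).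
have e0 : 0 < eta by rewrite lt_min ltr01 divr_gt0.
have e1 : eta <= 1 by rewrite ge_min lexx.
have De : D * eta <= c.
  apply: (@le_trans _ _ ((D + 1) * eta)); first by rewrite ler_wpM2r ?lerDl// ltW.
  by rewrite mulrC -ler_pdivlMr// ge_min lexx orbT.
have pert (t : R) (g : 'M[R]_n) (u : 'rV[R]_m) :
    (forall i, `|(row_mx t%:M u0 : 'rV[R]_(1 + m)) 0 i| <= A) ->
    (forall i j, `|g i j - g0 i j| <= eta) ->
    (forall i, `|u 0 i - u0 0 i| <= eta) ->
    `|F (row_mx t%:M u0 *m g0) - F (row_mx t%:M u *m g)| <= c.
  move=> tA gg uu; apply: le_trans De.
  have uu' i : `|(row_mx t%:M u0 : 'rV[R]_(1 + m)) 0 i - (row_mx t%:M u : 'rV[R]_(1 +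
    m)) 0 i| <= eta.
    rewrite !mxE; case: splitP => j _; first by rewrite subrr normr0 ltW.
    by rewrite distrC.
  have gA i j : `|g0 i j| <= A by rewrite (le_trans (hA3 i j))// lerDr addr_ge0.
  have bd (x0 x : R) : `|x0| <= A -> `|x0 - x| <= eta -> `|x| <= A + 1.
    move=> h1 h2; rewrite (_ : x = x0 - (x0 - x)); last by ring.
    by rewrite (le_trans (ler_normB _ _))// lerD// (le_trans h2).
  have -> : D * eta = n%:R * (d%:R * K ^+ d.-1 * (n%:R * ((2 * A + 1) * eta))).
    by rewrite /D; ring.
  apply: F0_lipschitz.
  - move=> i; apply: mulmx_row_bound => [j|j k]; first by rewrite (le_trans (tA j))//
    lerDl.
    by rewrite (le_trans (gA j k))// lerDl.
  - move=> i; apply: mulmx_row_bound => [j|j k]; first exact: bd (tA j) (uu' j).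
    by apply: bd (gA j k) _; rewrite distrC.
  - move=> j; apply: le_trans (mulmx_row_perturb tA uu' gA gg j) _.
    rewrite ler_wpM2l// ler_wpM2r ?(ltW e0)//.
    by rewrite lerD2l.
exists a, (a + s), u0, c, eta; split=> // g u gg uu.
have c1 : 2 * c <= - F y by rewrite mulrC divfK// ge_min lexx.
have c2 : 2 * c <= F (y + s *: row 0 g0) by rewrite mulrC divfK// ge_min lexx orbT.
have := pert a g u _ gg uu; rewrite ya => /(_ _)/ler_normlP h1.
have := pert (a + s) g u _ gg uu; rewrite yb => /(_ _)/ler_normlP h2.
split.
  case: h1 => [i|]; first by rewrite (le_trans (hA1 i))// /A -addrA lerDl addr_ge0.
  by lra.
case: h2 => [i|]; first by rewrite (le_trans (hA2 i))// /A addrAC lerDr addr_ge0.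
by lra.
Qed.

(** Along the line [F - xi] is a polynomial in the first coordinate, so the intermediate value
    theorem for polynomials applies, whichever of [a] and [b] is larger. *)
Lemma F0_line_root (a b xi : R) (u : 'rV[R]_m) (g : 'M[R]_n) :
  F (row_mx a%:M u *m g) <= xi -> xi <= F (row_mx b%:M u *m g) ->
  exists2 x, `|x| <= Num.max `|a| `|b| & F (row_mx x%:M u *m g) = xi.
Proof.
move=> Fa Fb.
pose f : {poly R} := \sum_(i < n) (if (i < p)%N then 1 else -1)%:P *
  ((g (lshift m 0) i)%:P * 'X + ((row_mx 0 u *m g) 0 i)%:P) ^+ d - xi%:P.
have fE x : f.[x] = F (row_mx x%:M u *m g) - xi.
  rewrite /f hornerD hornerN hornerC; congr (_ - _).
  rewrite F0E horner_sum; apply: eq_bigr => i _.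
  rewrite hornerM hornerC horner_exp !hornerE; congr (_ * _ ^+ _).
  rewrite (_ : row_mx x%:M u = row_mx x%:M 0 + row_mx 0 u); last first.
    by rewrite add_row_mx addr0 add0r.
  rewrite mulmxDl [RHS]mxE; congr (_ + _).
  rewrite [RHS]mxE big_split_ord /= big_ord1 row_mxEl mxE mulr1n big1 ?addr0 1?mulrC//.
  by move=> j _; rewrite row_mxEr mxE mul0r.
have [ab|/ltW ba] := lerP a b.
  have [|x /andP[ax xb]] := @poly_ivt _ f a b ab.
    by rewrite !fE subr_le0 Fa subr_ge0.
  rewrite rootE fE subr_eq0 => /eqP Fx; exists x => //.
  by have := ler_norm a; have := ler_norm (- a); have := ler_norm b; have := ler_norm
    (- b);
    rewrite !normrN le_max; case: (ger0P x) => _ *; apply/orP; lra.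
have [|x /andP[ax xb]] := @poly_ivt _ (- f) b a ba.
  by rewrite !hornerN !fE; lra.
rewrite rootE hornerN fE oppr_eq0 subr_eq0 => /eqP Fx; exists x => //.
by have := ler_norm a; have := ler_norm (- a); have := ler_norm b; have := ler_norm
  (- b);
    rewrite !normrN le_max; case: (ger0P x) => _ *; apply/orP; lra.
Qed.

End Local.

(** * Intervals of residues modulo a prime *)

Definition Fp_interval P (z : int) L : {set 'F_P} :=
  [set (z + i%:Z)%:~R | i : 'I_L]%SET.

Lemma card_Fp_interval P z L : prime P -> (L <= P)%N -> #|Fp_interval P z L| = L.
Proof.
move=> pP LP; rewrite card_imset ?card_ord// => i j /eqP.
rewrite -subr_eq0 -intrB Fp_intr_eq0// => h.
apply/val_inj => /=; have := ltn_ord i; have := ltn_ord j.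
move: h; move: (nat_of_ord i) (nat_of_ord j) => a b h bL aL.
have [//|ne] := eqVneq a b.
by have := dvdn_leq _ h; lia.
Qed.

(** Lifts the congruence modulo [P] to an identity of integers; the quotient [v] will be the first
    coordinate of the integer solution. *)
Lemma dotp_Fp_interval P m (u : 'I_m -> int) (r : 'rV['F_P]_m) z L : prime P ->
  dotp (\row_i (u i)%:~R) r \in Fp_interval P z L ->
  exists (v : int) (i : nat), (i < L)%N /\
    v * P%:Z + \sum_j (r 0 j : nat)%:Z * u j = z + i%:Z.
Proof.
move=> pP /imsetP[i _ h]; exists ((z + i%:Z - \sum_j (r 0 j : nat)%:Z * u j) %/
  P%:Z)%Z, i.
split=> //; rewrite divzK ?subrK//.
rewrite dvdzE -Fp_intr_eq0// intrB subr_eq0 -h rmorph_sum /=.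
apply/eqP/eq_bigr => j _; rewrite mxE intrM; congr (_ * _).
by rewrite -pmulrn natr_Zp.
Qed.

(** * Shears and integer vectors *)

Lemma pow2_unbounded (R : archiRealFieldType) (X : R) : exists c, X <= 2 ^+ c.
Proof.
exists (Num.truncn X).+1; apply: le_trans (ltW (Num.Theory.truncnS_gt X)) _.
by rewrite -natrX ler_nat ltnW// ltn_expl.
Qed.

Lemma enorm_le (R : realType) n (v : 'rV[R]_n) B : 0 <= B ->
  (forall i, `|v 0 i| <= B) -> enorm v <= n%:R * B.
Proof.
move=> B0 vB; rewrite /enorm -[leRHS]ger0_norm ?mulr_ge0// -sqrtr_sqr ler_wsqrtr//.
apply: (@le_trans _ _ (n%:R * B ^+ 2)).
  rewrite -[X in X%:R * _](card_ord n) mulr_natl -sumr_const.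
  by apply: ler_sum => i _; rewrite -real_normK ?num_real// lerXn2r// nnegrE.
rewrite exprMn ler_wpM2r ?exprn_ge0// -natrX ler_nat.
by case: n {v vB} => // n; rewrite expnS leq_pmulr// expn_gt0.
Qed.

Definition shear (R : pzRingType) m (s : 'cV[R]_m) : 'M[R]_(1 + m) :=
  block_mx 1%:M 0 s 1%:M.

(* The extra factor [M] keeps the shears close to the identity; it is harmless
   because they will only be applied to vectors whose last coordinates are
   multiples of [M]. *)
Definition grid_point (R : unitRingType) P M m (r : 'rV['F_P]_m) : 'cV[R]_m :=
  \col_i ((r 0 i : nat)%:R / (M * P)%:R).

(** [M] cancels, so the sheared first coordinate is a multiple of [1 / P] whose numerator is
    congruent to the dot product of [u] and [r] modulo [P]. *)
Lemma int_vec_shear (R : realType) P M m (r : 'rV['F_P]_m) (v : int) (u : 'I_m -> int) :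
  (0 < P)%N -> (0 < M)%N ->
  int_vec R (row_mx v%:M (\row_j (M%:Z * u j)) : 'rV[int]_(1 + m))
    *m shear (grid_point R M r) =
  row_mx ((v * P%:Z + \sum_j (r 0 j : nat)%:Z * u j)%:~R / P%:R)%:M
         (\row_j (M%:R * (u j)%:~R)).
Proof.
move=> P0 M0; have Pn0 : P%:R != 0 :> R by rewrite pnatr_eq0 -lt0n.
have Mn0 : M%:R != 0 :> R by rewrite pnatr_eq0 -lt0n.
rewrite /int_vec /shear map_row_mx mul_row_block !mulmx1 mulmx0 add0r.
congr row_mx; last by apply/rowP => j; rewrite !mxE rmorphM.
apply/rowP => i; rewrite !ord1 !mxE eqxx !mulr1n intrD intrM mulrDl mulfK//.
congr (_ + _); rewrite rmorph_sum mulr_suml; apply: eq_bigr => j _.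
rewrite !mxE !rmorphM /= -!pmulrn.
by field; rewrite Pn0 Mn0.
Qed.

(** * Roots and approximate solutions at a large scale *)

Section Local.
Variables (R : realType) (m p d : nat).
Local Notation n := (1 + m)%N.
Local Notation F := (@F0 R n p d).
Implicit Types (g : 'M[R]_(1 + m)) (w : 'rV[R]_m).

(** By homogeneity, dilation by [lam] turns a sign change of size [c] into one of size
    [c * lam ^+ d], which reaches past [xi]. *)
Lemma scaled_root (a b xi c eta lam : R) (u0 : 'rV[R]_m) g w :
  0 < lam -> `|xi| <= c * lam ^+ d ->
  (forall u : 'rV[R]_m, (forall i, `|u 0 i - u0 0 i| <= eta) ->
      F (row_mx a%:M u *m g) <= - c /\ c <= F (row_mx b%:M u *m g)) ->
  (forall i, `|w 0 i - lam * u0 0 i| <= lam * eta) ->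
  exists2 x, `|x| <= lam * (`|a| + `|b|) & F (row_mx x%:M w *m g) = xi.
Proof.
move=> lam0 xic sgn wu.
have scal t : row_mx (lam * t)%:M w *m g = lam *: (row_mx t%:M (lam^-1 *: w) *m g).
  rewrite scalemxAl scale_row_mx scale_scalar_mx scalerA mulfV ?scale1r//.
  exact: lt0r_neq0.
have [|Fa Fb] := sgn (lam^-1 *: w).
  move=> i; rewrite mxE; have := wu i.
  rewrite -{1}(mulVKf (lt0r_neq0 lam0) (w 0 i)) -mulrBr normrM gtr0_norm//.
  by rewrite ler_pM2l.
have l0 : 0 < lam ^+ d by rewrite exprn_gt0.
move: xic; rewrite ler_norml => /andP[xi1 xi2].
have [||x xab Fx] := @F0_line_root R m p d (lam * a) (lam * b) xi w g.
- rewrite scal F0Z (le_trans _ xi1)// -mulNr mulrC ler_wpM2r// ltW//.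
- by rewrite scal F0Z (le_trans xi2)// mulrC ler_wpM2l// ltW.
exists x => //; apply: le_trans xab _; rewrite ge_max !normrM gtr0_norm//.
by apply/andP; split; rewrite ler_wpM2l ?(ltW lam0)// ?lerDl ?lerDr.
Qed.

(** The slope along the line is of order [B^(d - 1)]; this fixes the length of the interval around a
    root. *)
Lemma F0_line_lipschitz (x y B G : R) g w :
  `|x| <= B -> `|y| <= B -> (forall i, `|w 0 i| <= B) -> (forall i j, `|g i j| <= G) ->
  `|F (row_mx x%:M w *m g) - F (row_mx y%:M w *m g)| <=
    n%:R * (d%:R * (n%:R * (B * G)) ^+ d.-1 * (n%:R * (`|x - y| * G))).
Proof.
move=> xB yB wB gG; have rB z : `|z| <= B ->
    forall i, `|(row_mx z%:M w : 'rV[R]_(1 + m)) 0 i| <= B.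
  by move=> zB i; rewrite mxE; case: splitP => j _//; rewrite ord1 mxE mulr1n.
apply: F0_lipschitz => i; first exact: mulmx_row_bound (rB x xB) gG i.
  exact: mulmx_row_bound (rB y yB) gG i.
have -> : (row_mx x%:M w *m g) 0 i - (row_mx y%:M w *m g) 0 i =
    ((row_mx (x - y)%:M 0 : 'rV[R]_(1 + m)) *m g) 0 i.
  have -> : row_mx (x - y)%:M 0 = row_mx x%:M w - row_mx y%:M w :> 'rV[R]_(1 + m).
    by rewrite opp_row_mx add_row_mx subrr raddfB.
  by rewrite mulmxBl !mxE.
apply: mulmx_row_bound gG i => j; rewrite mxE; case: splitP => k _.
  by rewrite ord1 mxE mulr1n.
by rewrite mxE normr0.
Qed.

(* With [tau = 2^-kappa], the width [tau^(j+1) = (2^(j+1))^-kappa] is at most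
   [t^-kappa] for every [t] between [2^j] and [2^(j+1)]. *)
Definition no_solution (tau xi : R) j g := forall v : 'rV[int]_(1 + m),
  enorm (int_vec R v) <= 2 ^+ j -> tau ^+ j.+1 <= `|F (int_vec R v *m g) - xi|.

End Local.

Section Local.
Variables (R : realType) (m p d : nat).
Local Notation n := (1 + m)%N.
Local Notation F := (@F0 R n p d).
Implicit Types (g : 'M[R]_(1 + m)).

(** If the dot product fell into the interval, its lift would be an integer vector whose sheared
    first coordinate [x] is within [ell] of the root [x0], hence a solution. *)
Lemma no_solution_miss (tau xi x0 B G ell : R) j g M P (r : 'rV['F_P]_m)
    (u : 'I_m -> int) L :
  prime P -> (0 < M)%N -> `|x0| + 1 <= B ->
  (forall i, `|M%:R * (u i)%:~R| <= B) -> (forall i j, `|g i j| <= G) ->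
  F (row_mx x0%:M (\row_i (M%:R * (u i)%:~R)) *m g) = xi ->
  L%:R <= ell * P%:R -> ell <= 1 ->
  n%:R * (d%:R * (n%:R * (B * G)) ^+ d.-1 * (n%:R * (ell * G))) < tau ^+ j.+1 ->
  n%:R * (n%:R * B) <= 2 ^+ j ->
  no_solution p d tau xi j (shear (grid_point R M r) *m g) ->
  dotp (\row_i (u i)%:~R) r \notin Fp_interval P (Num.ceil (P%:R * x0)) L.
Proof.
move=> pP M0 x0B uB gG Fx0 LP ell1 small normB nosol.
apply/negP => /(dotp_Fp_interval pP) [v [i [iL hv]]].
have P0 : (0 < P)%N := prime_gt0 pP.
have P0' : 0 < P%:R :> R by rewrite ltr0n.
have B0 : 0 <= B by rewrite (le_trans _ x0B)// addr_ge0.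
have G0 : 0 <= G by rewrite (le_trans _ (gG 0 0)).
set z := Num.ceil (P%:R * x0) in hv *.
pose x : R := (z + i%:Z)%:~R / P%:R.
have zx : P%:R * x0 <= z%:~R < P%:R * x0 + 1.
  rewrite ceil_ge /=; have := ceilB1_lt (P%:R * x0).
  by rewrite -/z intrB ltrBlDr.
have xz : x * P%:R = z%:~R + i%:R by rewrite divfK ?lt0r_neq0// intrD pmulrn.
have iL' : i%:R + 1 <= L%:R :> R by rewrite natr1 ler_nat.
(* Rounding up costs less than [1 / P] and [i <= L - 1], so the distance to [x0] is at most
   [L / P]. *)
have xx0 : 0 <= x - x0 <= ell.
  have : 0 <= i%:R :> R by [].
  move: zx LP => /andP[z1 z2]; rewrite mulrC => LP i0; apply/andP; split.
    by rewrite subr_ge0 -(ler_pM2l P0') (mulrC _ x) xz; lra.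
  by rewrite -(ler_pM2l P0') mulrBr (mulrC _ x) xz; lra.
pose w : 'rV[R]_m := \row_i (M%:R * (u i)%:~R).
have xB : `|x| <= B.
  rewrite (_ : x = x0 + (x - x0)); last by ring.
  rewrite (le_trans (ler_normD _ _))// (le_trans _ x0B)// lerD2l.
  by case/andP: xx0 => h ?; rewrite ger0_norm//; lra.
have Fx : `|F (row_mx x%:M w *m g) - xi| < tau ^+ j.+1.
  rewrite -Fx0; apply: le_lt_trans small.
  apply: (le_trans (F0_line_lipschitz p d xB _ _ gG)).
  - by rewrite (le_trans _ x0B)// lerDl.
  - by move=> k; rewrite mxE.
  rewrite ger0_norm; last by case/andP: xx0.
  by do ?[rewrite ler_wpM2l// | rewrite ler_wpM2r//]; rewrite ?mulr_ge0 ?exprn_ge0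
    ?mulr_ge0 //; case/andP: xx0.
pose vec : 'rV[int]_(1 + m) := row_mx v%:M (\row_j (M%:Z * u j)).
have := nosol vec; rewrite mulmxA int_vec_shear// hv -/x -/w => /(_ _)/(lt_le_trans Fx).
rewrite ltxx => /(_ _)/negP; apply; last by [].
apply: le_trans normB; apply: enorm_le => [|k]; first by rewrite mulr_ge0.
have uB' l : `|(u l)%:~R| <= B :> R.
  apply: le_trans (uB l); rewrite normrM ler_peMl// ger0_norm// ler1n//.
have m0 : 0 <= m%:R :> R by [].
rewrite /int_vec mxE; case: (splitP k) => [l kl|l kl].
  have -> : k = lshift m l by apply/val_inj.
  rewrite row_mxEl ord1 mxE mulr1n.
  (* Undoing the shear: the weights [r / P] are below 1, so [v] is at most [B + m * B]. *)
  have -> : v%:~R = x - \sum_l (r 0 l : nat)%:R / P%:R * (u l)%:~R.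
    apply: (mulIf (lt0r_neq0 P0')); rewrite mulrBl xz mulr_suml.
    rewrite (pmulrn 1 i) -intrD -hv intrD intrM -pmulrn rmorph_sum /=.
    rewrite [X in _ = _ + X - _](eq_bigr (fun l => (r 0 l : nat)%:R / P%:R * (u
      l)%:~R * P%:R)) ?addrK//.
    by move=> l' _; rewrite mulrAC divfK ?lt0r_neq0// rmorphM /= -pmulrn.
  rewrite natrD mulrDl mul1r (le_trans (ler_normB _ _))// lerD//.
  rewrite (le_trans (ler_norm_sum _ _ _))//.
  rewrite -[X in X%:R * _](card_ord m) mulr_natl -sumr_const.
  apply: ler_sum => l' _; rewrite normrM (le_trans _ (uB' l'))// ler_piMl//.
  rewrite ger0_norm ?divr_ge0// ler_pdivrMr// mul1r ler_nat ltnW//.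
  by rewrite -[X in (_ < X)%N](card_Fp pP) card_ord; exact: ltn_ord.
have -> : k = rshift 1 l by apply/val_inj.
rewrite row_mxEr mxE rmorphM /= -pmulrn (le_trans (uB l))//.
by rewrite ler_peMl// natrD lerDl.
Qed.

End Local.

(** * The fraction of shears without a solution *)

Section Local.
Variables (R : realType) (m p d : nat).
Local Notation n := (1 + m)%N.
Local Notation F := (@F0 R n p d).
Implicit Types (g : 'M[R]_(1 + m)).

(** For [tau = 2^(- kappa)] the base of the geometric factor is [2^(kappa + d - n)], and [k.+1]
    stands for [log t]. The radius [eta] precedes [M] because [M] is later chosen in terms of
    [eta]. *)
Lemma fraction_without_solution (tau xi : R) (g0 : 'M[R]_(1 + m)) :
  (1 < m)%N -> (0 < p < n)%N -> (1 < d)%N -> ~~ odd d -> 0 < tau -> tau <= 1 ->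
  \det g0 = 1 ->
  exists2 eta : R, 0 < eta & forall M, (0 < M)%N ->
  exists (C : R) (k0 c0 : nat), 0 <= C /\ forall k, (k0 <= k)%N ->
  exists2 P, prime P & forall g : 'M[R]_(1 + m), (forall i j, `|g i j - g0 i j| <=
    eta) ->
    #|[set r : 'rV['F_P]_m |
        `[< no_solution p d tau xi (k + c0) (shear (grid_point R M r) *m g) >]]|%:R
    <= C * k.+1%:R * (2 ^+ d.-1 / (tau * 2 ^+ m)) ^+ k * (P ^ m)%:R.
Proof.
move=> m1 pn d1 dev tau0 tau1 dg.
have kc i j : ((i + j).+1 <= j.+1 * i.+1)%N by rewrite mulSn mulnS; lia.
have d0 : (0 < d)%N by exact: ltnW.
have [a [b [u0 [c [eta [c_gt0 eta0 eta1 sgn]]]]]] := @uniform_signs R m p d g0 pn d1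
  dev dg.
exists eta => // M M0.
have [A1 A10 hA1] := row_bounded u0.
have [G0 G00 hG0] := mx_bounded g0.
pose A := `|a| + `|b| + A1 + 1; pose G := G0 + 1.
have A0 : 0 < A by rewrite /A ltr_wpDl// !addr_ge0.
have G_gt0 : 0 < G by rewrite ltr_wpDl.
have M0' : 1 <= M%:R :> R by rewrite ler1n.
have M0'' : 0 < M%:R :> R by rewrite ltr0n.
(* Dyadic room for constants: [c1] for the entries of [u], [k0] for the size of [xi], [c0] for the
   norm of the integer vectors. *)
have [c1 hc1] := pow2_unbounded (A / eta).
have [k0 hk0] := pow2_unbounded (`|xi| / c).
have [c0 hc0] := pow2_unbounded (n%:R * (n%:R * (M%:R / eta * A))).
pose Q : R := n%:R * (d%:R * (n%:R * (M%:R / eta * A * G)) ^+ d.-1 * (n%:R * G)).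
have Q0 : 0 < Q.
  have n0 : 0 < n%:R :> R by rewrite ltr0n.
  by rewrite /Q; do ?[apply: exprn_gt0 | apply: mulr_gt0 | rewrite invr_gt0 | rewrite
    ltr0n].
(* Makes [ell <= 1 / 2] and [Q * c2 <= tau ^+ c0.+1 / 2], so that the error stays strictly below
   [tau ^+ (k + c0).+1]. *)
pose c2 := Num.min 2^-1 (tau ^+ c0.+1 / (2 * Q)).
have c20 : 0 < c2 by rewrite lt_min invr_gt0 ltr0n /= divr_gt0 ?exprn_gt0// mulr_gt0.
have t2 : tau / 2 ^+ d.-1 <= 1.
  by rewrite ler_pdivrMr ?exprn_gt0// mul1r (le_trans tau1)// exprn_ege1// ler1n.
have t20 : 0 < tau / 2 ^+ d.-1 by rewrite divr_gt0 ?exprn_gt0.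
exists (12 * 3 ^+ m * 2 ^+ (c1 * m) * c1.+1%:R / c2), k0, c0; split.
  by rewrite divr_ge0 ?(ltW c20)// mulr_ge0// mulr_ge0 ?exprn_ge0// mulr_ge0//
    exprn_ge0.
move=> k k0k.
pose ell := c2 * (tau / 2 ^+ d.-1) ^+ k.
have ell0 : 0 < ell by rewrite mulr_gt0 ?exprn_gt0.
have ell1 : ell <= 2^-1.
  rewrite -[leRHS]mulr1 ler_pM ?(ltW c20) ?exprn_ge0 ?(ltW t20) ?ge_min ?lexx//.
  by rewrite exprn_ile1// ltW.
pose K := (k + c1)%N.
(* [P] exceeds all minors, and [ell * P >= 2] ensures that rounding down to [L] loses at most a
   factor 2. *)
have [P PN pP] := prime_above (maxn (2 * (2 ^ K) ^ 2) (Num.truncn (2 / ell)).+1).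
have P1 : (2 * (2 ^ K) ^ 2 < P)%N by apply: leq_ltn_trans PN; exact: leq_maxl.
have P2 : 2 <= ell * P%:R.
  rewrite mulrC -ler_pdivrMr// (le_trans (ltW (Num.Theory.truncnS_gt _)))// ler_nat.
  by rewrite ltnW//; apply: leq_ltn_trans PN; exact: leq_maxr.
have P0 : (0 < P)%N := prime_gt0 pP.
have P0' : 0 < P%:R :> R by rewrite ltr0n.
pose L := Num.truncn (ell * P%:R).
have /andP[L1 L2] : L%:R <= ell * P%:R < L.+1%:R.
  by apply: Num.Theory.truncn_itv; rewrite mulr_ge0 ?ltW.
have LP : (L <= P)%N.
  rewrite -(ler_nat R) (le_trans L1)// ler_piMl// (le_trans ell1)//.
  by rewrite invf_le1// ler1n.
have L3 : ell * P%:R <= 2 * L%:R by move: L2; rewrite -natr1; lra.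
exists P => // g gg.
have H0 : 0 < 2 ^+ k :> R by rewrite exprn_gt0.
have H1 : 1 <= 2 ^+ k :> R by rewrite exprn_ege1// ler1n.
pose lam : R := M%:R * 2 ^+ k / eta.
have lame : lam * eta = M%:R * 2 ^+ k by rewrite divfK// lt0r_neq0.
have lamH : 2 ^+ k <= lam.
  rewrite ler_pdivlMr//; apply: (@le_trans _ _ (2 ^+ k)); first by rewrite ler_piMr//
    ltW.
  by rewrite ler_peMl// ltW.
have lam1 : 1 <= lam by exact: le_trans lamH.
have lam0 : 0 < lam by exact: lt_le_trans lam1.
have lamM : lam = M%:R / eta * 2 ^+ k by rewrite /lam mulrAC.
(* The vectors [M u], for [u] in a cube of side [2^k], stay within [lam eta] of
   [lam u0]. *)
pose cc i := Num.floor (2 ^+ k * u0 0 i / eta).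
pose u (x : {ffun 'I_m -> 'I_(2 ^ k)}) i : int := cc i + (x i)%:Z.
have gG i j : `|g i j| <= G.
  rewrite -(subrK (g0 i j) (g i j)) (le_trans (ler_normD _ _))// addrC lerD//.
  exact: le_trans (gg i j) eta1.
have f1 x i : `|M%:R * (u x i)%:~R - lam * u0 0 i| <= lam * eta.
  rewrite lame.
  have -> : M%:R * (u x i)%:~R - lam * u0 0 i =
      M%:R * ((u x i)%:~R - 2 ^+ k * u0 0 i / eta).
    by rewrite /lam; field; rewrite lt0r_neq0.
  rewrite normrM ger0_norm// ler_pM2l// /u intrD -pmulrn.
  have /andP[fl1 fl2] := floor_itv (2 ^+ k * u0 0 i / eta).
  have xi1 : (x i)%:R + 1 <= 2 ^+ k :> R by rewrite natr1 -natrX ler_nat.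
  have xi0 : 0 <= (x i)%:R :> R by [].
  move: fl1 fl2 xi0 xi1; rewrite -/(cc i) intrD; clear => fl1 fl2 xi0 xi1.
  by rewrite ler_norml; apply/andP; split; lra.
have f2 x i : `|M%:R * (u x i)%:~R| <= lam * (A1 + 1).
  rewrite -(subrK (lam * u0 0 i) (M%:R * _)) (le_trans (ler_normD _ _))//.
  rewrite addrC mulrDr lerD//; first by rewrite normrM gtr0_norm// ler_wpM2l// ltW.
  by rewrite (le_trans (f1 x i))// ler_wpM2l// ltW.
have lA1 : lam * (A1 + 1) <= lam * A.
  by rewrite ler_wpM2l ?(ltW lam0)// /A; have := normr_ge0 a; have := normr_ge0 b; lra.
have f3 x i : `|u x i| <= (2 ^ K)%N%:Z.
  rewrite -(ler_int R) intr_norm -pmulrn natrX exprD.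
  have := le_trans (f2 x i) lA1; rewrite normrM ger0_norm// lamM => h.
  have {}h : M%:R * `|(u x i)%:~R| <= M%:R * (2 ^+ k * (A / eta)).
    by apply: le_trans h _; rewrite le_eqVlt; apply/orP; left; apply/eqP; field;
      rewrite lt0r_neq0.
  by rewrite ler_pM2l// in h; apply: le_trans h _; rewrite ler_wpM2l// ltW.
have root x : exists2 x0, `|x0| <= lam * (`|a| + `|b|) &
    F (row_mx x0%:M (\row_i (M%:R * (u x i)%:~R)) *m g) = xi.
  apply: (@scaled_root R m p d a b xi c eta lam u0 g) => //.
  - move: hk0; rewrite ler_pdivrMr// mulrC => h; apply: le_trans h _.
    rewrite ler_wpM2l ?(ltW c_gt0)//; apply: (@le_trans _ _ lam).
      by apply: le_trans lamH; rewrite ler_eXn2l// ltr1n.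
    by rewrite -[leLHS]expr1 ler_weXn2l.
  - by move=> w hw; apply: sgn.
  - by move=> i; rewrite mxE.
have [x0 hx0] := choice (fun x => let: ex_intro2 y h1 h2 := root x in ex_intro _ y
  (conj h1 h2)).
(* If [u x] were zero, the zero vector would be close to [u0], and [sgn] would give both signs on
   the line through the origin, where [F] is [t ^+ d] times a constant with [d] even. *)
have un0 x : exists i, u x i != 0.
  apply: contrapT => /forallNP u00.
  have {}u00 i : u x i = 0 by apply/eqP/negPn/negP; exact: u00.
  pose z : 'rV[R]_m := 0.
  have [||z1 z2] := sgn g z => //.
    move=> i; have := f1 x i; rewrite u00 mulr0 /z mxE !sub0r !normrN normrM
      gtr0_norm//.
    by rewrite ler_pM2l.
  have Fz (t : R) : F (row_mx t%:M z *m g) = t ^+ d * F (row_mx 1%:M z *m g).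
    rewrite -F0Z scalemxAl scale_row_mx scale_scalar_mx mulr1 /z scaler0//.
  rewrite (Fz a) in z1; rewrite (Fz b) in z2.
  have pw (t : R) : 0 <= t ^+ d by rewrite exprn_even_ge0.
  have [F1|F1] := leP 0 (F (row_mx 1%:M z *m g)).
    by have := mulr_ge0 (pw a) F1; lra.
  by have := mulr_ge0_le0 (pw b) (ltW F1); lra.
pose J x := Fp_interval P (Num.ceil (P%:R * x0 x)) L.
have JL x : #|J x| = L by apply: card_Fp_interval.
have := @card_dotp_box_miss m K k P L cc J m1 pP P1 f3 un0 JL.
set Z := #|_|; set Z' := #|_|; move=> hZ.
have ZZ : (Z' <= Z)%N.
  apply: subset_leq_card; apply/fintype.subsetP => r; rewrite !inE => nosol.
  apply/forallP => x.
  apply: (@no_solution_miss R m p d tau xi (x0 x) (lam * A) G ell (k + c0) g M P r (u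
    x) L) => //.
  - have [h _] := hx0 x; apply: (@le_trans _ _ (lam * (`|a| + `|b|) + lam)); first by
    rewrite lerD.
    by rewrite /A -[X in _ + X]mulr1 -mulrDr ler_wpM2l ?(ltW lam0)// -!addrA !lerD2l
      lerDr.
  - by move=> i; apply: le_trans lA1.
  - by case: (hx0 x).
  - by rewrite (le_trans ell1)// invf_le1// ler1n.
  - have -> : n%:R * (d%:R * (n%:R * (lam * A * G)) ^+ d.-1 * (n%:R * (ell * G))) =
       Q * ((2 ^+ k) ^+ d.-1 * ell).
      have -> : n%:R * (lam * A * G) = n%:R * (M%:R / eta * A * G) * 2 ^+ k.
        by rewrite lamM; ring.
      by rewrite exprMn /Q; ring.
    have -> : (2 ^+ k) ^+ d.-1 * ell = c2 * tau ^+ k.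
      rewrite /ell exprMn exprVn -exprM mulnC exprM.
      by field; rewrite expf_neq0// expf_neq0// pnatr_eq0.
    have h : Q * c2 <= tau ^+ c0.+1 / 2.
      apply: (@le_trans _ _ (Q * (tau ^+ c0.+1 / (2 * Q)))).
        by rewrite ler_wpM2l ?(ltW Q0)// ge_min lexx orbT.
      by rewrite le_eqVlt; apply/orP; left; apply/eqP; field; rewrite lt0r_neq0.
    rewrite mulrA -addnS addnC exprD; apply: (@le_lt_trans _ _ (tau ^+ c0.+1 / 2 *
      tau ^+ k)).
      by rewrite ler_wpM2r// exprn_ge0// ltW.
    rewrite ltr_pM2r ?exprn_gt0// ltr_pdivrMr// ltr_pMr ?exprn_gt0// ltr1n//.
  - rewrite lamM (addnC k) exprD.
    have -> : n%:R * (n%:R * (M%:R / eta * 2 ^+ k * A)) = n%:R * (n%:R * (M%:R / eta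
      * A)) * 2 ^+ k by ring.
    by rewrite ler_wpM2r// ltW.
have {}hZ : Z'%:R * L%:R * (2 ^+ k ^+ m) ^+ 2 <=
   (P ^ m)%:R * P%:R * (6 * 3 ^+ m * (2 ^+ k ^+ m * 2 ^+ (c1 * m)) * (c1.+1%:R *
     k.+1%:R)) :> R.
  have h : (Z' * L * (2 ^ (k * m) * 2 ^ (k * m)) <= P ^ m * P * (6 * 3 ^ m * (2 ^ (k
    * m) * 2 ^ (c1 * m)) * (c1.+1 * k.+1)))%N.
    rewrite mulnn; apply: (@leq_trans (Z * L * (2 ^ (k * m)) ^ 2)); first by rewrite
      !leq_mul2r ZZ !orbT.
    apply: leq_trans hZ _; rewrite -expnD -mulnDl -/K leq_mul2l; apply/orP; right.
    by rewrite leq_mul2l kc orbT.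
  by move: h; rewrite -(ler_nat R) !natrM !(natrX _ 2) !(natrX _ 3) !exprM expr2.
set T : R := 2 ^+ k ^+ m in hZ.
have T0 : 0 < T by rewrite !exprn_gt0.
(* [T] is the number of vectors [u]: up to constants and the factor [k.+1], Chebyshev's bound is
   [1 / (ell * T)]. *)
have S : (2 ^+ d.-1 / (tau * 2 ^+ m)) ^+ k = c2 / (ell * T).
  rewrite /ell /T -exprM mulnC exprM expr_div_n exprMn expr_div_n.
  have d20 : 2 ^+ d.-1 ^+ k != 0 :> R by rewrite expf_neq0// expf_neq0// pnatr_eq0.
  have m20 : 2 ^+ m ^+ k != 0 :> R by rewrite expf_neq0// expf_neq0// pnatr_eq0.
  have tk0 : tau ^+ k != 0 by rewrite expf_neq0// lt0r_neq0.
  by field; rewrite d20 m20 tk0 lt0r_neq0.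
rewrite S.
have step : Z'%:R * (ell * P%:R) * T ^+ 2 <= 2 * ((P ^ m)%:R * P%:R *
    (6 * 3 ^+ m * (T * 2 ^+ (c1 * m)) * (c1.+1%:R * k.+1%:R))).
  apply: (@le_trans _ _ (2 * (Z'%:R * L%:R * T ^+ 2))); last by rewrite ler_pM2l.
  rewrite [leRHS]mulrA ler_wpM2r ?exprn_ge0 ?(ltW T0)//.
  by rewrite [leRHS]mulrCA ler_wpM2l.
have E0 : 0 < ell * P%:R * T ^+ 2 by rewrite !mulr_gt0 ?exprn_gt0.
rewrite -(ler_pM2r E0) mulrA; apply: le_trans step _.
rewrite le_eqVlt; apply/orP; left; apply/eqP; field.
by rewrite !lt0r_neq0.
Qed.

End Local.

Local Open Scope classical_set_scope.
Local Open Scope ring_scope.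

(** * Topology and measure on the special linear group *)

Section ContinuousBigop.
Variables (R : realType) (T : topologicalType) (I : Type).
Implicit Types (f : I -> T -> R) (s : seq I).

Lemma continuous_sumr s f : (forall i, continuous (f i)) ->
  continuous (fun x => \sum_(i <- s) f i x).
Proof.
move=> cf; elim: s => [|i s IH].
  rewrite (_ : (fun _ => _) = fun=> 0); first exact: cst_continuous.
  by apply/funext => x; rewrite big_nil.
rewrite (_ : (fun _ => _) = f i + (fun x => \sum_(i <- s) f i x)).
  by move=> x; apply: continuousD; [exact: cf|exact: IH].
by apply/funext => x; rewrite big_cons.
Qed.

Lemma continuous_prodr s f : (forall i, continuous (f i)) ->
  continuous (fun x => \prod_(i <- s) f i x).
Proof.
move=> cf; elim: s => [|i s IH].
  rewrite (_ : (fun _ => _) = fun=> 1); first exact: cst_continuous.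
  by apply/funext => x; rewrite big_nil.
rewrite (_ : (fun _ => _) = f i \* (fun x => \prod_(i <- s) f i x)).
  by move=> x; apply: continuousM; [exact: cf|exact: IH].
by apply/funext => x; rewrite big_cons.
Qed.

End ContinuousBigop.

Lemma continuous_mulrl (R : realType) (T : topologicalType) (a : R) (f : T -> R) :
  continuous f -> continuous (fun x => a * f x).
Proof.
by move=> cf x; apply: (@continuousM R T (fun=> a) f x); [exact:
  cst_continuous|exact: cf].
Qed.

Lemma continuous_det_vec_mx (R : realType) n :
  continuous (fun v : 'rV[R]_(n * n) => \det (vec_mx v)).
Proof.
have cv i j : continuous (fun v : 'rV[R]_(n * n) => vec_mx v i j).
  rewrite (_ : (fun _ => _) = fun v : 'rV[R]_(n * n) => v 0 (mxvec_index i j)).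
    exact: coord_continuous.
  by apply/funext => v; rewrite mxE.
apply: continuous_sumr => s; apply: continuous_mulrl; apply: continuous_prodr => i.
exact: cv.
Qed.

Section SpecialLinear.
Variables (R : realType) (n : nat).
Implicit Types (g h : SL R n) (A c : 'M[R]_n).

Lemma SL_det g : \det (SL_val g) = 1.
Proof. exact: (set_mem (valP g)). Qed.

Lemma SL_val_inj : injective (@SL_val R n).
Proof. exact: val_inj. Qed.

Definition SL_of A (dA : \det A = 1) : SL R n :=
  exist (fun x => x \in @SL_set R n) A (mem_set dA).

Lemma SL_ofK A (dA : \det A = 1) : SL_val (SL_of dA) = A.
Proof. by []. Qed.

Lemma SL_valM g h : SL_val (SL_mul g h) = SL_val g *m SL_val h.
Proof. by []. Qed.

Lemma SL_val_continuous : continuous (@SL_val R n).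
Proof. exact: initial_continuous. Qed.

Lemma SL_coord_continuous i j : continuous (fun g => SL_val g i j).
Proof.
move=> g; apply: (@continuous_comp _ _ _ (@SL_val R n) (fun A : 'M[R]_n => A i j)).
  exact: SL_val_continuous.
exact: coord_continuous.
Qed.

Lemma SL_mulmx_coord_continuous A i j : continuous (fun g => (A *m SL_val g) i j).
Proof.
rewrite (_ : (fun _ => _) = fun g => \sum_k A i k * SL_val g k j).
  by apply: continuous_sumr => k; apply: continuous_mulrl; exact: SL_coord_continuous.
by apply/funext => g; rewrite mxE.
Qed.

Lemma SL_row_coord_continuous (v : 'rV[R]_n) j : continuous (fun g => (v *m SL_val g)
  0 j).
Proof.
rewrite (_ : (fun _ => _) = fun g => \sum_k v 0 k * SL_val g k j).
  by apply: continuous_sumr => k; apply: continuous_mulrl; exact: SL_coord_continuous.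
by apply/funext => g; rewrite mxE.
Qed.

Lemma closed_norm_le (T : topologicalType) (f : T -> R) (a b : R) :
  continuous f -> closed [set x | `|f x - a| <= b].
Proof.
move=> cf; apply: (@preimage_closed _ _ (fun x => `|f x - a|) [set y | y <= b]).
  move=> x _; apply: (@continuous_comp _ _ _ (fun x => f x - a) (fun y : R => `|y|));
    last exact: norm_continuous.
  by apply: continuousB; [exact: cf|exact: cst_continuous].
exact: closed_le.
Qed.

Lemma closed_norm_ge (T : topologicalType) (f : T -> R) (a b : R) :
  continuous f -> closed [set x | b <= `|f x - a|].
Proof.
move=> cf; apply: (@preimage_closed _ _ (fun x => `|f x - a|) [set y | b <= y]).
  move=> x _; apply: (@continuous_comp _ _ _ (fun x => f x - a) (fun y : R => `|y|));
    last exact: norm_continuous.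
  by apply: continuousB; [exact: cf|exact: cst_continuous].
exact: closed_ge.
Qed.

Lemma SL_closed_measurable (C : set (SL R n)) :
  closed C -> measurable (C : set (SL_borel R n)).
Proof.
move=> cC; rewrite -(setCK C); apply: measurableC.
by apply: sub_sigma_algebra; exact: closed_openC.
Qed.

Definition entrywise_near c e A := forall i j, `|A i j - c i j| <= e.

Lemma closed_entrywise_near c e A :
  closed [set g : SL R n | entrywise_near c e (A *m SL_val g)].
Proof.
rewrite (_ : [set _ | _] =
  \bigcap_(ij in [set: 'I_n * 'I_n]) [set g : SL R n | `|(A *m SL_val g) ij.1 ij.2 -
    c ij.1 ij.2| <= e]).
  by apply: closed_bigI => ij _; apply: closed_norm_le; exact:
    SL_mulmx_coord_continuous.
apply/seteqP; split => [g hg [i j] _|g hg i j]; first exact: hg.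
exact: (hg (i, j)).
Qed.

(** Flattened to vectors, the set is a compact box cut by the closed condition that the determinant
    is 1. A cluster point found there is again in the group, and the subspace topology carries it
    back. *)
Lemma compact_entrywise_near c e :
  compact [set g : SL R n | entrywise_near c e (SL_val g)].
Proof.
pose B := [set v : 'rV[R]_(n * n) | forall i, `[mxvec c 0 i - e, mxvec c 0 i +
  e]%classic (v ord0 i)].
pose D := [set v : 'rV[R]_(n * n) | \det (vec_mx v) = 1].
have cB : compact B.
  by apply: (@rV_compact _ _ (fun i => `[mxvec c 0 i - e, mxvec c 0 i + e]%classic))
    => i; exact: segment_compact.
have cD : closed D.
  apply: (@preimage_closed _ _ (fun v : 'rV[R]_(n * n) => \det (vec_mx v)) [set 1]).
    by move=> v _; exact: continuous_det_vec_mx.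
  exact: closed_eq.
have cBD : compact (B `&` D).
  apply: (@subclosed_compact _ _ B); [|exact: cB|exact: subIsetl].
  by apply: closedI => //; apply: compact_closed => //; exact: norm_hausdorff.
move=> F PF FW.
pose f (g : SL R n) : 'rV[R]_(n * n) := mxvec (SL_val g).
have FB : (f @ F) (B `&` D).
  rewrite /fmap /=; apply: filterS FW => g hg; split.
    move=> k; case/mxvec_indexP: k => i j; rewrite /f !mxvecE /= in_itv /=.
    by rewrite -ler_distl; exact: hg.
  by rewrite /D /f /= mxvecK SL_det.
have [v [[Bv Dv] clv]] := cBD (f @ F) _ FB.
exists (SL_of Dv); split.
  move=> i j; rewrite /SL_val /= mxE; have := Bv (mxvec_index i j).
  by rewrite /= in_itv /= mxvecE -ler_distl.
move=> A O FA; rewrite nbhsE => -[V [[W oW <-] Wv] sub].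
have nv : nbhs v [set w : 'rV[R]_(n * n) | W (vec_mx w)].
  have : nbhs (vec_mx v : 'M[R]_n) W by exact: open_nbhs_nbhs.
  move=> /nbhs_ballP[r r0 hr]; apply/nbhs_ballP; exists r => // w [_ vw].
  by apply: hr; split => // i j; rewrite !mxE; exact: vw.
have FA' : (f @ F) (f @` A).
  by rewrite /fmap /=; apply: filterS FA => g Ag; exists g.
have [w [[g Ag gw] Ow]] := clv _ _ FA' nv.
exists g; split => //; apply: sub.
by move: Ow; rewrite -gw /f /= mxvecK.
Qed.

End SpecialLinear.

(** * Averaging a measure over a finite family of sets *)

Section Multiplicity.
Context d (T : measurableType d) (R : realType) (mu : {measure set T -> \bar R}).
Local Open Scope ereal_scope.

(** The sum of the measures is the integral over [Y] of the number of sets containing a point. *)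
Lemma sum_measure_le_multiplicity (I : finType) (X : I -> set T) (Y : set T) (b : R) :
  (forall i, measurable (X i)) -> measurable Y -> (forall i, X i `<=` Y) ->
  (forall y, Y y -> (#|[set i | `[< X i y >]]%SET|%:R <= b)%R) ->
  \sum_i mu (X i) <= b%:E * mu Y.
Proof.
move=> mX mY XY hb.
have -> : \sum_i mu (X i) = \int[mu]_(x in Y) \sum_i (\1_(X i) x)%:E.
  rewrite ge0_integral_sum//; first by apply: eq_bigr => i _; rewrite
    integral_indic// setIidl.
    by move=> i; exact/measurable_EFinP/measurable_indic.
rewrite -integral_cst//; apply: ge0_le_integral => //.
- by move=> x _; apply: sume_ge0 => i _; rewrite lee_fin.
- by apply: emeasurable_sum => i; exact/measurable_EFinP/measurable_indic.
- move=> x Yx; rewrite sumEFin lee_fin; apply: le_trans (hb x Yx).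
  rewrite -sum1_card [in leRHS]big_mkcond natr_sum; apply: ler_sum => i _.
  rewrite indicE finset.inE (_ : (x \in X i) = `[< X i x >]); last by [].
  by case: asbool.
Qed.

End Multiplicity.

(** * Borel-Cantelli for linear-geometric bounds *)

Lemma sum_linear_geometric_bounded (R : realFieldType) (rho : R) : 0 < rho -> rho < 1 ->
  exists2 C, 0 <= C & forall N, \sum_(0 <= k < N) k.+1%:R * rho ^+ k <= C.
Proof.
move=> r0 r1; have r1' : 0 < 1 - rho by rewrite subr_gt0.
exists ((1 - rho) ^- 2); first by rewrite invr_ge0 exprn_ge0// ltW.
move=> N; rewrite -[leRHS]mul1r ler_pdivlMr ?exprn_gt0//.
(* Closed form of the partial sum; the terms other than 1 add up to at most 0. *)
have -> : (\sum_(0 <= k < N) k.+1%:R * rho ^+ k) * (1 - rho) ^+ 2 =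
    1 - N.+1%:R * rho ^+ N + N%:R * rho ^+ N.+1.
  elim: N => [|N IH]; first by rewrite big_nil; ring.
  rewrite big_nat_recr//= mulrDl IH -!natr1 !exprS; ring.
have : N%:R * rho ^+ N.+1 <= N.+1%:R * rho ^+ N.
  rewrite exprS mulrA ler_wpM2r ?exprn_ge0 ?(ltW r0)// -natr1.
  have : N%:R * rho <= N%:R by rewrite ler_piMr// ltW.
  lra.
lra.
Qed.

Lemma sume_const (R : realType) (I : finType) (x : \bar R) : (0 <= x)%E ->
  (\sum_(i : I) x)%E = ((#|I|%:R)%:E * x)%E.
Proof.
move=> x0; rewrite big_const; elim: #|I| => [|k IH]; first by rewrite mul0e.
by rewrite iterS IH -natr1 EFinD ge0_muleDl// mul1e addeC.
Qed.

Section BorelCantelli.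
Context dd (T : measurableType dd) (R : realType) (mu : {measure set T -> \bar R}).

Lemma lim_sup_set_linear_geometric (E : (set T)^nat) (a rho : R) :
  0 <= a -> 0 < rho -> rho < 1 -> (forall k, measurable (E k)) ->
  (forall k, mu (E k) <= (a * (k.+1%:R * rho ^+ k))%:E)%E ->
  mu (lim_sup_set E) = 0%E.
Proof.
move=> a0 r0 r1 mE muE; apply: lim_sup_set_cvg0 => //.
have [C C0 hC] := sum_linear_geometric_bounded r0 r1.
apply: (@le_lt_trans _ _ (a * C)%:E); last by rewrite ltry.
apply: lime_le; first by apply: is_cvg_nneseries.
apply: nearW => N; apply: (@le_trans _ _ (\sum_(0 <= k < N) (a * (k.+1%:R * rho ^+
  k))%:E)%E).
  by apply: lee_sum => k _; exact: muE.
by rewrite sumEFin lee_fin -mulr_sumr ler_wpM2l.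
Qed.

End BorelCantelli.

(** * Null sets near a given matrix *)

Section Local.
Variables (R : realType) (m p d : nat).
Local Notation n := (1 + m)%N.

Lemma det_shear (s : 'cV[R]_m) : \det (shear s) = 1.
Proof. by rewrite det_lblock !det1 mulr1. Qed.

Lemma shear_opp (s : 'cV[R]_m) : shear (- s) *m shear s = 1%:M.
Proof.
rewrite /shear mulmx_block !mulmx1 !mul1mx !mulmx0 !mul0mx !addr0 add0r addNr.
by rewrite -scalar_mx_block.
Qed.

(** The shear fixes the first row and adds [s l] times it to each other row; that row is bounded by
    [G + e]. *)
Lemma shear_near (s : 'cV[R]_m) (g c : 'M[R]_n) (e t G : R) :
  0 <= t -> (forall i, `|s i 0| <= t) -> (forall i j, `|c i j| <= G) ->
  entrywise_near c e (shear s *m g) -> entrywise_near c (e + t * (G + e)) g.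
Proof.
move=> t0 st cG near i j; have e0 : 0 <= e by rewrite (le_trans _ (near i j)).
have row0 (k : 'I_n) : (shear s *m g) (lshift m 0) k = g (lshift m 0) k.
  rewrite mxE big_split_ord /= big_ord1 block_mxEul mxE eqxx mul1r big1 ?addr0// => l _.
  by rewrite block_mxEur mxE mul0r.
have rowS l (k : 'I_n) : (shear s *m g) (rshift 1 l) k = s l 0 * g (lshift m 0) k + g
  (rshift 1 l) k.
  rewrite mxE big_split_ord /= big_ord1 block_mxEdl; congr (_ + _).
  rewrite (bigD1 l)//= block_mxEdr mxE eqxx mul1r big1 ?addr0// => l' l'l.
  by rewrite block_mxEdr mxE eq_sym (negbTE l'l) mul0r.
have G0 : 0 <= G by rewrite (le_trans _ (cG i j)).
have g0 : `|g (lshift m 0) j| <= G + e.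
  rewrite -(subrK (c (lshift m 0) j) (g (lshift m 0) j)) (le_trans (ler_normD _ _))//
    addrC lerD//.
  by rewrite -row0.
have := near i j; case: (split_ordP i) => l ->.
  by rewrite ord1 row0 => h; apply: le_trans h _; rewrite lerDl mulr_ge0// addr_ge0.
rewrite rowS => h.
rewrite (_ : _ - _ = (s l 0 * g (lshift m 0) j + g (rshift 1 l) j - c (rshift 1 l) j)
  - s l 0 * g (lshift m 0) j); last by ring.
by rewrite (le_trans (ler_normB _ _))// lerD// normrM ler_pM.
Qed.

(** An intersection of closed conditions, one per integer vector, thanks to the non-strict
    inequality; this provides measurability. *)
Lemma closed_no_solution (tau xi : R) j (A : 'M[R]_n) :
  closed [set g : SL R n | no_solution p d tau xi j (A *m SL_val g)].
Proof.
rewrite (_ : [set _ | _] = \bigcap_(v in [set v : 'rV[int]_(1 + m) | enorm (int_vec R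
  v) <= 2 ^+ j])
    [set g : SL R n | tau ^+ j.+1 <= `|F0 p d (int_vec R v *m A *m SL_val g) - xi|]).
  apply: closed_bigI => v _; apply: closed_norm_ge.
  rewrite (_ : (fun _ => _) = fun g : SL R n =>
     \sum_(i < 1 + m) (if (i < p)%N then 1 else -1) * ((int_vec R v *m A *m SL_val g)
       0 i) ^+ d).
    apply: continuous_sumr => i; apply: continuous_mulrl => g.
    apply: (@continuous_comp _ _ _ (fun g : SL R n => (int_vec R v *m A *m SL_val g)
      0 i) (fun x : R => x ^+ d)).
      exact: SL_row_coord_continuous.
    exact: exprn_continuous.
  by apply/funext => g; rewrite F0E.
apply/seteqP; split => [g hg v hv|g hg v hv].
  by rewrite /= -mulmxA; exact: hg.
by rewrite mulmxA; exact: hg.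
Qed.

(** The sets [X r] have equal measure by left invariance and lie in the compact set [Y], and each
    point of [Y] is in a small fraction of them. This bounds the measure of the bad set at scale
    [k + c0], and Borel-Cantelli concludes. *)
Lemma local_negligible (mu : {measure set (SL_borel R n) -> \bar R}) (tau xi : R) (g0
  : SL R n) :
  (1 < m)%N -> (0 < p < n)%N -> (1 < d)%N -> ~~ odd d -> 0 < tau -> tau <= 1 ->
  2 ^+ d.-1 < tau * 2 ^+ m -> is_haar mu ->
  exists2 eta : R, 0 < eta & mu.-negligible
    [set g : SL_borel R n | entrywise_near (SL_val g0) eta (SL_val g) /\
       forall k, exists2 j, (k <= j)%N & no_solution p d tau xi j (SL_val g)].
Proof.
move=> m1 pn d1 dev tau0 tau1 dm [haar cfin _].
have kc i j : ((i + j).+1 <= j.+1 * i.+1)%N by rewrite mulSn mulnS; lia.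
have [eta eta0 H] := @fraction_without_solution R m p d tau xi (SL_val g0) m1 pn d1
  dev tau0 tau1 (SL_det g0).
have [G G0 hG] := mx_bounded (SL_val g0).
have e20 : 0 < eta / 2 by rewrite divr_gt0.
(* Shears with entries at most [1 / M] then pull [W] back inside [Y]. *)
pose M := (Num.truncn ((G + eta / 2) / (eta / 2))).+1.
have M0 : (0 < M)%N by [].
have M0' : 0 < M%:R :> R by rewrite ltr0n.
have MG : M%:R^-1 * (G + eta / 2) <= eta / 2.
  by rewrite mulrC ler_pdivrMr// [leRHS]mulrC -ler_pdivrMr// ltW//; exact:
    Num.Theory.truncnS_gt.
have [C [k0 [c0 [C0 {}H]]]] := H M M0.
pose W : set (SL_borel R n) := [set g | entrywise_near (SL_val g0) (eta / 2) (SL_val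
  g)].
pose Y : set (SL_borel R n) := [set g | entrywise_near (SL_val g0) eta (SL_val g)].
pose B j : set (SL_borel R n) := [set g | no_solution p d tau xi j (SL_val g)].
pose rho := 2 ^+ d.-1 / (tau * 2 ^+ m).
have tm0 : 0 < tau * 2 ^+ m by rewrite mulr_gt0// exprn_gt0.
have rho0 : 0 < rho by rewrite divr_gt0// exprn_gt0.
have rho1 : rho < 1 by rewrite ltr_pdivrMr// mul1r.
have mXA (A : 'M[R]_n) j e : measurable ([set g | no_solution p d tau xi j (A *m
  SL_val g) /\
     entrywise_near (SL_val g0) e (A *m SL_val g)] : set (SL_borel R n)).
  apply: (@SL_closed_measurable R n); apply: closedI; first exact: closed_no_solution.
  exact: closed_entrywise_near.
have mBW j : measurable (B j `&` W).
  have := mXA 1%:M j (eta / 2); rewrite (_ : [set _ | _] = B j `&` W)//.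
  by apply/seteqP; split => g; rewrite /B /W /= mul1mx.
have Yfin : (mu Y < +oo)%E by apply: cfin; exact: compact_entrywise_near.
have mY : measurable Y.
  apply: (@SL_closed_measurable R n).
  rewrite (_ : Y = [set g : SL R n | entrywise_near (SL_val g0) eta (1%:M *m SL_val
    g)]).
    exact: closed_entrywise_near.
  by apply/seteqP; split => g; rewrite /Y /= mul1mx.
have fY : mu Y \is a fin_num by rewrite ge0_fin_numE.
have bound k : (k0 <= k)%N -> (mu (B (k + c0)%N `&` W) <= (C * k.+1%:R * rho ^+ k)%:E
  * mu Y)%E.
  move=> k0k; have [P pP {}H] := H k k0k.
  have P0 : (0 < P)%N := prime_gt0 pP.
  pose X (r : 'rV['F_P]_m) : set (SL_borel R n) := [set g |
     no_solution p d tau xi (k + c0) (shear (grid_point R M r) *m SL_val g) /\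
     entrywise_near (SL_val g0) (eta / 2) (shear (grid_point R M r) *m SL_val g)].
  (* [X r] is the preimage of [B (k + c0) `&` W] under a shear. *)
  have muX r : mu (X r) = mu (B (k + c0)%N `&` W).
    rewrite -(haar (SL_of (det_shear (- grid_point R M r))) _ (mBW (k + c0)%N)).
    congr (mu _); apply/seteqP; split => [g [h1 h2]|_ [g [h1 h2] <-]].
      exists (SL_mul (SL_of (det_shear (grid_point R M r))) g) => //.
      by apply: SL_val_inj; rewrite !SL_valM !SL_ofK mulmxA shear_opp mul1mx.
    have : shear (grid_point R M r) *m SL_val (SL_mul (SL_of (det_shear (- grid_point
      R M r))) g) = SL_val g.
      have := shear_opp (- grid_point R M r); rewrite opprK => h.
      by rewrite SL_valM SL_ofK mulmxA h mul1mx.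
    by move=> E; split; rewrite E.
  have XY r : X r `<=` Y.
    move=> g [_ h]; have hs i : `|(grid_point R M r) i 0| <= M%:R^-1.
      rewrite mxE ger0_norm ?divr_ge0// natrM invfM mulrCA ler_piMr ?invr_ge0//.
      rewrite ler_pdivrMr ?ltr0n// mul1r ler_nat ltnW//.
      by rewrite -[X in (_ < X)%N](card_Fp pP) card_ord; exact: ltn_ord.
    have Mi0 : 0 <= M%:R^-1 :> R by rewrite invr_ge0.
    move=> i j; apply: le_trans (shear_near Mi0 hs hG h i j) _.
    by move: MG; lra.
  have hb y : Y y -> (#|[set r | `[< X r y >]]%SET|%:R <= C * k.+1%:R * rho ^+ k * (P
    ^ m)%:R).
    move=> Yy; apply: le_trans (H (SL_val y) Yy); rewrite ler_nat.
    apply: subset_leq_card; apply/fintype.subsetP => r; rewrite !finset.inE =>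
      /asboolW[h _].
    exact/asboolT.
  have := sum_measure_le_multiplicity mu (fun r => mXA _ _ _) mY XY hb.
  rewrite (eq_bigr (fun=> mu (B (k + c0)%N `&` W))); last by move=> r _; exact: muX.
  have Pm0 : (0 < (P ^ m)%:R%:E :> \bar R)%E by rewrite lte_fin ltr0n expn_gt0 P0.
  rewrite sume_const// card_mx card_Fp// mul1n mulrC EFinM -muleA.
  by rewrite lee_pmul2l.
(* Reindexed so that every scale is in the range [k0 <= k] of the bound; the shift in the linear
   factor goes into [a]. *)
pose E k := B (k + k0 + c0)%N `&` W.
pose a := C * k0.+1%:R * rho ^+ k0 * fine (mu Y).
have a0 : 0 <= a by rewrite !mulr_ge0 ?exprn_ge0 ?(ltW rho0) ?fine_ge0.
have E0 : mu (lim_sup_set E) = 0%E.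
  apply: (@lim_sup_set_linear_geometric _ _ _ mu E a rho) => //; first by move=> k;
    exact: mBW.
  move=> k; apply: le_trans (bound (k + k0)%N (leq_addl _ _)) _.
  rewrite -(fineK fY) -EFinM lee_fin /a exprD.
  have -> : C * k0.+1%:R * rho ^+ k0 * fine (mu Y) * (k.+1%:R * rho ^+ k) =
    (k0.+1%:R * k.+1%:R) * (C * (rho ^+ k * rho ^+ k0) * fine (mu Y)) by ring.
  have -> : C * (k + k0).+1%:R * (rho ^+ k * rho ^+ k0) * fine (mu Y) =
    (k + k0).+1%:R * (C * (rho ^+ k * rho ^+ k0) * fine (mu Y)) by ring.
  rewrite ler_wpM2r ?mulr_ge0 ?exprn_ge0 ?(ltW rho0) ?fine_ge0//.
  by rewrite -natrM ler_nat kc.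
exists (eta / 2) => //; exists (lim_sup_set E); split => //.
  apply: bigcap_measurable => // k _; apply: bigcup_measurable => j _; exact: mBW.
move=> g [gW gB] k _; have [j kj gj] := gB (k + (k0 + c0))%N.
exists (j - (k0 + c0))%N; first by rewrite /= -(leq_add2r (k0 + c0)) subnK//
  (leq_trans _ kj)// leq_addl.
by rewrite /E -addnA subnK ?(leq_trans _ kj) ?leq_addl.
Qed.

End Local.

(** * From local to global null sets *)

Lemma rational_matrix_near (R : realType) n (g : 'M[R]_n) (e : R) : 0 < e ->
  exists Q : 'M[rat]_n, entrywise_near (map_mx ratr Q) e g.
Proof.
move=> e0; have h ij : exists q : rat, `|g ij.1 ij.2 - ratr q| <= e.
  have [|q] := @rat_in_itvoo R (g ij.1 ij.2 - e) (g ij.1 ij.2 + e); first by lra.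
  by rewrite in_itv /= => qe; exists q; rewrite distrC ler_distl !ltW; case/andP: qe.
have [f hf] := choice h; exists (\matrix_(i, j) f (i, j)) => i j.
by rewrite !mxE; exact: (hf (i, j)).
Qed.

(* Countably many entrywise balls with rational centres and radii [1 / k.+1]
   replace second countability of [SL R n]. *)
Lemma locally_negligible (R : realType) n (mu : {measure set (SL_borel R n) -> \bar R})
    (A : set (SL_borel R n)) :
  (forall g0 : SL R n, exists2 eta : R, 0 < eta & mu.-negligible
     [set g : SL_borel R n | entrywise_near (SL_val g0) eta (SL_val g) /\ A g]) ->
  mu.-negligible A.
Proof.
move=> loc.
pose U (c : 'M[rat]_n * nat) : set (SL_borel R n) :=
  [set g | entrywise_near (map_mx ratr c.1) c.2.+1%:R^-1 (SL_val g) /\ A g].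
(* Enumerates the balls by [pickle], keeping those whose trace on [A] is negligible. *)
pose N i : set (SL_borel R n) := if unpickle i is Some c then
  (if `[< mu.-negligible (U c) >] then U c else set0) else set0.
apply: (@negligibleS _ _ _ _ (\bigcup_i N i)); last first.
  apply: negligible_bigcup => i; rewrite /N; case: unpickle => [c|]; last exact:
    negligible_set0.
  by case: asboolP => // _; exact: negligible_set0.
move=> g Ag; have [eta eta0 negl] := loc g.
(* Twice the radius is at most [eta], so a rational ball containing [g] lies in the [eta]-ball
   around [g]. *)
pose k := Num.truncn (2 / eta).
have k0 : 0 < k.+1%:R^-1 :> R by rewrite invr_gt0 ltr0n.
have ke : 2 * k.+1%:R^-1 <= eta.
  rewrite ler_pdivrMr ?ltr0n// [leRHS]mulrC -ler_pdivrMr// ltW//; exact: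
    Num.Theory.truncnS_gt.
have [Q hQ] := rational_matrix_near (SL_val g) k0.
exists (pickle (Q, k)) => //; rewrite /N pickleK.
have -> : `[< mu.-negligible (U (Q, k)) >].
  apply/asboolT; apply: negligibleS negl => h [hU Ah]; split => // i j.
  rewrite -(subrK ((map_mx ratr Q : 'M[R]_n) i j) (SL_val h i j)) -addrA.
  rewrite (le_trans (ler_normD _ _))// (le_trans _ ke)// mulr_natl mulr2n lerD//.
  by rewrite distrC; exact: hQ.
by split.
Qed.

Theorem corollary1p1 (R : realType) (d p q n : nat)
  (mu : {measure set (SL_borel R n) -> \bar R}) (kappa xi : R) :
  (2 <= d)%N -> ~~ odd d -> (1 <= p)%N -> (1 <= q)%N ->
  n = (p + q)%N -> (d < n)%N ->
  is_haar mu ->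
  0 < kappa -> kappa < n%:R - d%:R ->
  almost_all_Y mu p d (fun F : 'rV[R]_n -> R =>
    \forall t \near +oo, exists v : 'rV[int]_n,
      `|F (int_vec R v) - xi| < t `^ (- kappa) /\ enorm (int_vec R v) <= t).
Proof.
case: n mu => [|m] mu d2 dev p1 q1 npq dn haar k0 kn; first by lia.
pose tau : R := 2 `^ (- kappa).
have tau0 : 0 < tau by rewrite powR_gt0.
have tau1 : tau <= 1 by rewrite -(powRr0 2) ler_powR ?ler1n// oppr_le0 ltW.
have tauX j : tau ^+ j = (2 ^+ j) `^ (- kappa).
  by rewrite -(powR_mulrn j (ltW tau0)) -(powR_mulrn j (ler0n _ 2)) /tau powRAC.
(* The hypothesis [kappa < n - d] in the form that makes the geometric ratio less than 1. *)
have dm : 2 ^+ d.-1 < tau * 2 ^+ m.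
  have : 2 `^ (d.-1)%:R < 2 `^ (- kappa + m%:R) :> R.
    rewrite /powR pnatr_eq0 /= ltr_expR ltr_pM2r ?ln_gt0 ?ltr1n//.
    have : (d.-1)%:R + 1 = d%:R :> R by rewrite natr1 prednK//; lia.
    by move: kn; rewrite -natr1; lra.
  by rewrite powRD ?pnatr_eq0 ?implybT// !powR_mulrn.
rewrite /almost_all_Y /prop_near1 /nbhs /= /almost_everywhere.
(* A form with arbitrarily large unsolvable [t] has unsolvable dyadic scales [j] beyond every
   bound. *)
apply: (@negligibleS _ _ _ mu [set g | forall k, exists2 j, (k <= j)%N & no_solution
  p d tau xi j (SL_val g)]).
  move=> g /= ngood k; apply: contrapT => nobad; apply: ngood.
  have sol j : (k <= j)%N -> exists v : 'rV[int]_(1 + m),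
      enorm (int_vec R v) <= 2 ^+ j /\ `|F0 p d (int_vec R v *m SL_val g) - xi| < tau
        ^+ j.+1.
    move=> kj; apply: contrapT => nov; apply: nobad; exists j => // v vj.
    by rewrite leNgt; apply/negP => vx; apply: nov; exists v.
  exists (2 ^+ k); split; first by rewrite num_real.
  move=> t kt; have t0 : 0 < t by rewrite (lt_trans _ kt)// exprn_gt0.
  have [c hc] := pow2_unbounded t.
  have ex : exists j, t <= 2 ^+ j by exists c.
  (* For the least such [j], scale [j.-1] serves [t]: the norm is at most [2^(j - 1) < t], and the
     error is below [tau ^+ j = (2^j)^(- kappa)], which is at most [t^(- kappa)]. *)
  case: (ex_minnP ex) => j tj jmin.
  have kj : (k < j)%N.
    rewrite ltnNge; apply/negP => jk; move: kt; rewrite ltNge => /negP; apply.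
    by rewrite (le_trans tj)// ler_weXn2l// ler1n.
  have j0 : (0 < j)%N by exact: leq_ltn_trans kj.
  have [v [v1 v2]] := sol j.-1 (ltac:(lia)); rewrite prednK// in v2.
  exists v; split; last first.
    apply: le_trans v1 _; rewrite leNgt; apply/negP => /ltW /jmin; lia.
  apply: lt_le_trans v2 _; rewrite tauX.
  rewrite !powRN lef_pV2 ?posrE ?powR_gt0 ?exprn_gt0//.
  by rewrite ge0_ler_powR ?nnegrE ?exprn_ge0 ?(ltW t0) ?(ltW k0).
apply: locally_negligible => g0.
apply: (@local_negligible R m p d mu tau xi g0) => //.
  (* From [n > d >= 2] follows [m >= 2], as the count of parallel pairs requires. *)
  by lia.
by rewrite p1 /=; lia.
Qed.
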